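(* Let $I,J,K,R$ be positive integers. The CPD of an $I\times J\times K$ tensor of rank $R$ is generically unique if there exist matrices $\mathbf A_0\in\mathbb F^{I\times R}$, $\mathbf B_0\in\mathbb F^{J\times R}$ and $\mathbf C_0\in\mathbb F^{K\times R}$ such that at least one of the following conditions holds: (i) $\mathcal C_{m_{\mathbf C}}(\mathbf A_0)\odot\mathcal C_{m_{\mathbf C}}(\mathbf B_0)$ has full column rank, where $m_{\mathbf C}=R-\min(K,R)+2$; (ii) $\mathcal C_{m_{\mathbf A}}(\mathbf B_0)\odot\mathcal C_{m_{\mathbf A}}(\mathbf C_0)$ has full column rank, where $m_{\mathbf A}=R-\min(I,R)+2$; (iii) $\mathcal C_{m_{\mathbf B}}(\mathbf C_0)\odot\mathcal C_{m_{\mathbf B}}(\mathbf A_0)$ has full column rank, where $m_{\mathbf B}=R-\min(J,R)+2$.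
   Context: $\mathbb F$ is $\mathbb R$ or $\mathbb C$. For matrices $\mathbf A\in\mathbb F^{I\times R},\mathbf B\in\mathbb F^{J\times R},\mathbf C\in\mathbb F^{K\times R}$ with nonzero columns, $[\mathbf A,\mathbf B,\mathbf C]_R:=\sum_{r=1}^R\mathbf a_r\circ\mathbf b_r\circ\mathbf c_r$ ($\circ$ = outer product). The rank $r_{\mathcal T}$ of a tensor is the minimal number of terms in such a representation; a representation with $r_{\mathcal T}$ terms is a canonical polyadic decomposition (CPD). The CPD of a tensor $\mathcal T$ of rank $R$ is unique if $\mathcal T=[\mathbf A,\mathbf B,\mathbf C]_R=[\bar{\mathbf A},\bar{\mathbf B},\bar{\mathbf C}]_R$ implies that there are an $R\times R$ permutation matrix $\mathbf\Pi$ and nonsingular diagonal matrices $\mathbf\Lambda_{\mathbf A},\mathbf\Lambda_{\mathbf B},\mathbf\Lambda_{\mathbf C}$ with $\bar{\mathbf A}=\mathbf A\mathbf\Pi\mathbf\Lambda_{\mathbf A}$, $\bar{\mathbf B}=\mathbf B\mathbf\Pi\mathbf\Lambda_{\mathbf B}$, $\bar{\mathbf C}=\mathbf C\mathbf\Pi\mathbf\Lambda_{\mathbf C}$, $\mathbf\Lambda_{\mathbf A}\mathbf\Lambda_{\mathbf B}\mathbf\Lambda_{\mathbf C}=\mathbf I_R$. Generic uniqueness: with $\mu$ the Lebesgue measure on $\mathbb F^{(I+J+K)R}$, the CPD of an $I\times J\times K$ tensor of rank $R$ is generically unique if $\mu\{(\mathbf A,\mathbf B,\mathbf C):\ \text{the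 CPD of the tensor }[\mathbf A,\mathbf B,\mathbf C]_R\text{ is not unique}\}=0$. $\odot$ is the Khatri-Rao (column-wise Kronecker) product. For $\mathbf M\in\mathbb F^{p\times R}$ the $k$-th compound matrix $\mathcal C_k(\mathbf M)$ is the $\binom pk\times\binom Rk$ matrix of all $k\times k$ minors of $\mathbf M$, with row and column index sets ordered lexicographically; it is defined for $k\le\min(p,R)$, and each of the conditions is understood to include that the compound matrices in it are defined. *)

(* Defs.v *)
From HB Require Import structures.
From mathcomp Require Import all_boot all_order all_algebra.
From mathcomp Require Import complex mxtens.
From mathcomp Require Import all_classical all_reals all_analysis.

Set Implicit Arguments.
Unset Strict Implicit.
Unset Printing Implicit Defensive.

Import Order.TTheory GRing.Theory Num.Theory.
Import numFieldNormedType.Exports.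

Local Open Scope classical_set_scope.
Local Open Scope ring_scope.

Section Decompositions.
Variable F : fieldType.
Implicit Types I J K r : nat.

Definition tensor I J K := {ffun 'I_I * 'I_J * 'I_K -> F}.

Definition outer3 I J K (a : 'cV[F]_I) (b : 'cV[F]_J) (c : 'cV[F]_K) :
    tensor I J K :=
  [ffun p => a p.1.1 0 * b p.1.2 0 * c p.2 0].

Definition polyadic I J K r
    (A : 'M[F]_(I, r)) (B : 'M[F]_(J, r)) (C : 'M[F]_(K, r)) : tensor I J K :=
  \sum_(s < r) outer3 (col s A) (col s B) (col s C).

Definition nonzero_columns m r (A : 'M[F]_(m, r)) : Prop :=
  forall s, col s A != 0.

Definition is_decomposition I J K r (T : tensor I J K)
    (A : 'M[F]_(I, r)) (B : 'M[F]_(J, r)) (C : 'M[F]_(K, r)) : Prop :=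
  [/\ nonzero_columns A, nonzero_columns B, nonzero_columns C
    & T = polyadic A B C].

Definition has_rank I J K (T : tensor I J K) r : Prop :=
  (exists A B C, @is_decomposition I J K r T A B C) /\
  (forall r' A B C, @is_decomposition I J K r' T A B C -> (r <= r')%N).

Definition same_up_to_perm_scaling I J K r
    (A : 'M[F]_(I, r)) (B : 'M[F]_(J, r)) (C : 'M[F]_(K, r))
    (A' : 'M[F]_(I, r)) (B' : 'M[F]_(J, r)) (C' : 'M[F]_(K, r)) : Prop :=
  exists P LA LB LC : 'M[F]_r,
    [/\ is_perm_mx P,
        [/\ is_diag_mx LA & LA \in unitmx],
        [/\ is_diag_mx LB & LB \in unitmx],
        [/\ is_diag_mx LC & LC \in unitmx]
      & [/\ A' = A *m P *m LA, B' = B *m P *m LB, C' = C *m P *m LC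
          & LA *m LB *m LC = 1%:M]].

(* The rank of T is part of the property: a representation of T with r terms
   is a CPD only if r is the rank of T. *)
Definition cpd_unique I J K r (T : tensor I J K) : Prop :=
  has_rank T r /\
  forall (A A' : 'M[F]_(I, r)) (B B' : 'M[F]_(J, r)) (C C' : 'M[F]_(K, r)),
    is_decomposition T A B C -> is_decomposition T A' B' C' ->
    same_up_to_perm_scaling A B C A' B' C'.

End Decompositions.

Section Compound.
Variable F : fieldType.
Implicit Types m n p q r k : nat.

(* The k-element subsets of {0, .., p-1}, as increasing k-tuples; the type
   k.-tuplelexi carries the lexicographic order, and Order.enum_val enumerates
   in increasing order. *)
Definition ksubset k p : {pred k.-tuplelexi 'I_p} :=
  [pred t : k.-tuplelexi 'I_p | sorted ltn [seq val i | i <- t]].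
Arguments ksubset : clear implicits.

Lemma card_ksubset k p : #|ksubset k p| = 'C(p, k).
Proof.
by rewrite -(card_ltn_sorted_tuples k p); apply: eq_card => t; rewrite !inE.
Qed.

Definition lex_ksubset k p (i : 'I_'C(p, k)) : k.-tuple 'I_p :=
  Order.enum_val (cast_ord (esym (card_ksubset k p)) i).

Definition compound k p r (M : 'M[F]_(p, r)) : 'M[F]_('C(p, k), 'C(r, k)) :=
  \matrix_(i, j) \det (mxsub (tnth (lex_ksubset i)) (tnth (lex_ksubset j)) M).

Definition khatri_rao m p n (A : 'M[F]_(m, n)) (B : 'M[F]_(p, n)) :
    'M[F]_(m * p, n) :=
  \matrix_(i, j) (A (mxtens_unindex i).1 j * B (mxtens_unindex i).2 j).

(* Beyond k <= min(p, r) the matrix [compound k] is only a junk matrix with no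
   rows or no columns, so the bounds are required explicitly. MathComp's
   [row_full] says that the rank equals the number of columns. *)
Definition compound_khatri_rao_full p q r k
    (A : 'M[F]_(p, r)) (B : 'M[F]_(q, r)) : Prop :=
  [/\ (k <= minn p r)%N, (k <= minn q r)%N
    & row_full (khatri_rao (compound k A) (compound k B))].

End Compound.

(* The product measure of the library. The alias is needed because the
   sigma-finite structure found by unification on [m1 \x m2] is the one for
   sub-probabilities. *)
Section ProductMeasure.
Local Open Scope ereal_scope.
Context d1 d2 (T1 : measurableType d1) (T2 : measurableType d2) (R : realType).
Variable m1 : {sigma_finite_measure set T1 -> \bar R}.
Variable m2 : {sigma_finite_measure set T2 -> \bar R}.

Definition prod_measure : set (T1 * T2) -> \bar R := m1 \x m2.

HB.instance Definition _ := Measure.on prod_measure.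

Let prod_measure_sigma_finite : sigma_finite setT prod_measure.
Proof.
have /sigma_finiteP[F [TF ndF Foo]] := sigma_finiteT m1.
have /sigma_finiteP[G [TG ndG Goo]] := sigma_finiteT m2.
exists (fun n => F n `*` G n).
  rewrite -setXTT TF TG predeqE => -[x y]; split; last first.
    by move=> [n _ []/= ? ?]; split; exists n.
  move=> [/= [n _ Fnx] [k _ Gky]]; exists (maxn n k) => //; split.
  - by move: x Fnx; exact/subsetPset/ndF/leq_maxl.
  - by move: y Gky; exact/subsetPset/ndG/leq_maxr.
move=> k; have [? ?] := Foo k; have [? ?] := Goo k.
split; first exact: measurableX.
by rewrite /prod_measure product_measure1E// lte_mul_pinfty// ge0_fin_numE.
Qed.

HB.instance Definition _ := Measure_isSigmaFinite.Build _ _ _ prod_measure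
  prod_measure_sigma_finite.

End ProductMeasure.

Section PowerMeasure.
Local Open Scope ereal_scope.
Context d (T : measurableType d) (R : realType).
Implicit Types n : nat.

Definition tuple_cons n (p : T * n.-tuple T) : n.+1.-tuple T :=
  [tuple of p.1 :: p.2].

Lemma measurable_tuple_cons n :
  measurable_fun [set: T * n.-tuple T] (@tuple_cons n).
Proof. exact: (measurable_cons measurable_fst measurable_snd). Qed.

Section step.
Variables (mu : {sigma_finite_measure set T -> \bar R}) (n : nat).
Variable nu : {sigma_finite_measure set (n.-tuple T) -> \bar R}.

Definition cons_measure : set (n.+1.-tuple T) -> \bar R :=
  pushforward (prod_measure mu nu) (@tuple_cons n).

Let cons_measure0 : cons_measure set0 = 0.
Proof. by rewrite /cons_measure /pushforward preimage_set0 measure0. Qed.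

Let cons_measure_ge0 A : 0 <= cons_measure A.
Proof. exact: (measure_ge0 (prod_measure mu nu)). Qed.

Let cons_measure_sigma_additive : semi_sigma_additive cons_measure.
Proof.
move=> A mA tA mUA; rewrite /cons_measure /pushforward preimage_bigcup.
have mpre B : measurable B -> measurable (@tuple_cons n @^-1` B).
  by move=> mB; rewrite -[X in measurable X]setTI; exact: measurable_tuple_cons.
apply: measure_semi_sigma_additive.
- by move=> i; exact: mpre.
- apply/trivIsetP => /= i j _ _ ij; rewrite -preimage_setI.
  by move/trivIsetP : tA => /(_ _ _ _ _ ij) ->//; rewrite preimage_set0.
- by rewrite -preimage_bigcup; exact: mpre.
Qed.

HB.instance Definition _ := isMeasure.Build _ _ _ cons_measure
  cons_measure0 cons_measure_ge0 cons_measure_sigma_additive.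

Let cons_measure_sigma_finite : sigma_finite setT cons_measure.
Proof.
have [G UG Gfin] := sigma_finiteT (prod_measure mu nu).
pose uncons (t : n.+1.-tuple T) := (thead t, [tuple of behead t]).
have consK p : uncons (tuple_cons p) = p.
  by case: p => x t; congr pair; apply: val_inj.
have muncons : measurable_fun setT uncons.
  apply/measurable_fun_pairP; split; first exact: measurable_tnth.
  exact: measurable_behead.
exists (fun i => uncons @^-1` G i).
  by rewrite -preimage_bigcup -UG preimage_setT.
move=> i; have [mG Goo] := Gfin i; split.
  by rewrite -[X in measurable X]setTI; exact: muncons.
rewrite /cons_measure /pushforward -comp_preimage.
rewrite (_ : uncons \o _ = idfun) ?preimage_id//.
by apply/funext => p; exact: consK.
Qed.

HB.instance Definition _ := Measure_isSigmaFinite.Build _ _ _ cons_measure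
  cons_measure_sigma_finite.

End step.

(* The n-fold product of mu with itself, on n-tuples. *)
Fixpoint power_measure (mu : {sigma_finite_measure set T -> \bar R}) n :
    {sigma_finite_measure set (n.-tuple T) -> \bar R} :=
  if n is n'.+1 then cons_measure mu (power_measure mu n')
  else dirac [tuple].

Lemma measurable_box n (A : 'I_n -> set T) :
  (forall i, measurable (A i)) ->
  measurable [set t : n.-tuple T | forall i, A i (tnth t i)].
Proof.
move=> mA.
rewrite (_ : [set _ | _] = \big[setI/setT]_(i < n) ((@tnth n T)^~ i @^-1` A i)).
  apply: bigsetI_measurable => i _.
  by rewrite -[X in measurable X]setTI; exact: measurable_tnth.
apply/seteqP; split=> t; rewrite -bigcap_seq/= => At i.
  by move=> _; exact: At.
by apply: At; rewrite /= mem_index_enum.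
Qed.

Lemma power_measure_box (mu : {sigma_finite_measure set T -> \bar R}) n
    (A : 'I_n -> set T) : (forall i, measurable (A i)) ->
  power_measure mu n [set t | forall i, A i (tnth t i)] =
  \big[*%E/1]_(i < n) mu (A i).
Proof.
elim: n A => [|n IHn] A mA.
  by rewrite big_ord0 /= diracE mem_set// => -[].
rewrite big_ord_recl -IHn//= /cons_measure /pushforward.
rewrite -product_measure1E//; last first.
  by apply: (@measurable_box n (fun i => A (lift ord0 i))) => i; exact: mA.
rewrite /prod_measure; congr product_measure1.
apply/seteqP; split=> -[x t] /=.
  by move=> At; split=> [|i]; [have := At ord0|have := At (lift ord0 i)];
    rewrite ?tnth0 ?tnthS.
move=> [Ax At] i; have [j ->|->] := unliftP ord0 i; rewrite ?tnthS ?tnth0//.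
Qed.

End PowerMeasure.

Variant scalars := RealScalars | ComplexScalars.

Section GenericUniqueness.
Variable R : realType.

Definition scalar_field (s : scalars) : fieldType :=
  match s with RealScalars => R | ComplexScalars => R[i]%C end.

Definition lebesgueR : {sigma_finite_measure set (measurableTypeR R) -> \bar R} :=
  lebesgue_measure.

Definition lebesgueR2 :
    {sigma_finite_measure set (measurableTypeR R * measurableTypeR R)%type -> \bar R} :=
  prod_measure lebesgueR lebesgueR.

(* S is a null set for (the completion of) Lebesgue measure on F^n, where C is
   identified with R^2 by the real and imaginary parts. *)
Definition lebesgue_null (s : scalars) n :
    set 'rV[scalar_field s]_n -> Prop :=
  match s return set 'rV[scalar_field s]_n -> Prop with
  | RealScalars => fun S =>
      (power_measure lebesgueR n).-negligible
        [set t : n.-tuple (measurableTypeR R) | S (\row_i tnth t i)%R]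
  | ComplexScalars => fun S =>
      (power_measure lebesgueR2 n).-negligible
        [set t : n.-tuple (measurableTypeR R * measurableTypeR R)%type |
          S (\row_i ((tnth t i).1 +i* (tnth t i).2)%C)%R]
  end.

(* The vector of all entries of the three factors, cut into the factors. *)
Definition factor_matrix (s : scalars) I J K r
    (v : 'rV[scalar_field s]_((I + J + K) * r)) :
    'M[scalar_field s]_(I + J + K, r) := vec_mx v.
Definition factorA s I J K r v : 'M[scalar_field s]_(I, r) :=
  usubmx (usubmx (@factor_matrix s I J K r v)).
Definition factorB s I J K r v : 'M[scalar_field s]_(J, r) :=
  dsubmx (usubmx (@factor_matrix s I J K r v)).
Definition factorC s I J K r v : 'M[scalar_field s]_(K, r) :=
  dsubmx (@factor_matrix s I J K r v).

Definition cpd_generically_unique (s : scalars) (I J K r : nat) : Prop :=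
  @lebesgue_null s ((I + J + K) * r)
    [set v | let A := factorA v in let B := factorB v in let C := factorC v in
       [/\ nonzero_columns A, nonzero_columns B, nonzero_columns C
         & ~ @cpd_unique _ I J K r (polyadic A B C)]].

End GenericUniqueness.

(* Main.v *)
(* Put k = min(K, r) and m = r - k + 2. Suppose that C_m(A) (.) C_m(B) has full
   column rank and that any k columns of C are independent. Then
   [A, B, C] = [A', B', C'] forces the two decompositions to agree, even if
   A', B', C' may have zero columns:
   - For a vector x the slices give A diag(C^T x) B^T = A' diag(C'^T x) B'^T.
     If C'^T x has fewer than m nonzero entries, all m-minors of the right-hand
     side vanish, so by Cauchy-Binet and full column rank C^T x also has fewer
     than m nonzero entries; comparing ranks, it has at most as many as C'^T x.
     By Kruskal's permutation lemma C' agrees with C up to permutation and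
     scaling.
   - Once C' = C, choosing x so that C^T x is supported on a given set U of
     m - 1 indices shows that the columns of A' in U lie in the span of the
     columns of A in U; intersecting over U gives a'_j = alpha_j a_j. The same
     holds for B, and the slices give alpha_j beta_j = 1.
   The two hypotheses follow from the nonvanishing of one polynomial, a maximal
   minor of the Khatri-Rao product times all top k-minors of C, which is nonzero
   at (A0, B0, Vandermonde). The zero set of a nonzero polynomial is null by
   Fubini. *)

Require Import Defs.
From mathcomp Require Import all_boot all_order all_algebra.
From mathcomp Require Import finmap complex mxtens perm zify ring.
From mathcomp Require Import all_classical all_reals all_analysis.
From mathcomp Require Import measurable_realfun.

Set Implicit Arguments.
Unset Strict Implicit.
Unset Printing Implicit Defensive.

Import Order.TTheory GRing.Theory Num.Theory.

Local Open Scope ring_scope.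

(** * Families of rows and Kruskal's permutation lemma *)

Section RowFamilies.
Variable F : fieldType.

Definition row_support n (u : 'rV[F]_n) : {set 'I_n} := [set j | u 0 j != 0].

(* The Kruskal rank of the family of rows of X is at least k. *)
Definition rows_indep k n p (X : 'M[F]_(n, p)) : Prop :=
  forall u : 'rV_n, (#|row_support u| <= k)%N -> u *m X = 0 -> u = 0.

Definition rows_in n p (X : 'M[F]_(n, p)) (S : {set 'I_n}) : 'M[F]_(#|S|, p) :=
  rowsub (fun i : 'I_#|S| => enum_val i) X.

Definition zero_rows n p (X : 'M[F]_(n, p)) (x : 'cV[F]_p) : {set 'I_n} :=
  [set j | (X *m x) j 0 == 0].

Lemma rows_inE n p (X : 'M[F]_(n, p)) (S : {set 'I_n}) :
  rows_in X S = rows_in 1%:M S *m X.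
Proof. by rewrite /rows_in rowsubE. Qed.

Lemma row_support_rows_in n (S : {set 'I_n}) (w : 'rV[F]_#|S|) :
  row_support (w *m rows_in 1%:M S) \subset S.
Proof.
apply/fintype.subsetP => j; rewrite inE; apply: contraNT => jS.
rewrite mxE big1// => i _; rewrite !mxE; case: eqP => [e|_]; last by rewrite mulr0.
by rewrite -e enum_valP in jS.
Qed.

Lemma rows_in_supportK n (S : {set 'I_n}) (u : 'rV[F]_n) :
  row_support u \subset S ->
  u = (\row_i u 0 (enum_val (i : 'I_#|S|))) *m rows_in 1%:M S.
Proof.
move=> uS; apply/rowP => j; rewrite mxE.
transitivity (\sum_(i in S) u 0 i * (i == j)%:R); last first.
  by rewrite big_enum_val; apply: eq_bigr => i _; rewrite !mxE.
have [jS|jS] := boolP (j \in S).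
  rewrite (bigD1 j)//= eqxx mulr1 big1 ?addr0// => i /andP[_ /negbTE->].
  by rewrite mulr0.
rewrite big1 => [|i iS]; last first.
  by case: eqP => [e|_]; [rewrite -e iS in jS|rewrite mulr0].
apply/eqP; apply: contraNT jS => uj; apply: (fintype.subsetP uS); by rewrite inE.
Qed.

Lemma rows_in_coords n (S : {set 'I_n}) (w : 'rV[F]_#|S|) :
  w *m rows_in 1%:M S = 0 -> w = 0.
Proof.
move=> w0; apply/rowP => i; rewrite [RHS]mxE.
have := congr1 (fun M : 'rV_n => M 0 (enum_val i)) w0.
rewrite !mxE (bigD1 i)//= big1 ?addr0 => [|l li].
  by rewrite !mxE eqxx mulr1.
by rewrite !mxE (inj_eq enum_val_inj) (negbTE li) mulr0.
Qed.

Lemma sub_rows_inP n p (X : 'M[F]_(n, p)) (S : {set 'I_n}) (v : 'rV_p) :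
  reflect (exists2 u, row_support u \subset S & v = u *m X) (v <= rows_in X S)%MS.
Proof.
apply: (iffP idP) => [/submxP[w ->]|[u uS ->]].
  exists (w *m rows_in 1%:M S); first exact: row_support_rows_in.
  by rewrite rows_inE mulmxA.
by rewrite (rows_in_supportK uS) -mulmxA -rows_inE submxMl.
Qed.

Lemma row_support_delta n (j : 'I_n) : row_support (delta_mx 0 j) = [set j].
Proof.
by apply/setP => i; rewrite !inE mxE eqxx /=; case: (i == j); rewrite ?oner_eq0 ?eqxx.
Qed.

Lemma row_rows_in n p (X : 'M[F]_(n, p)) (S : {set 'I_n}) j :
  j \in S -> (row j X <= rows_in X S)%MS.
Proof.
move=> jS; apply/sub_rows_inP; exists (delta_mx 0 j); last by rewrite rowE.
by rewrite row_support_delta finset.sub1set.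
Qed.

Lemma rows_in_sub n p m (X : 'M[F]_(n, p)) (S : {set 'I_n}) (B : 'M[F]_(m, p)) :
  (forall j, j \in S -> (row j X <= B)%MS) -> (rows_in X S <= B)%MS.
Proof.
move=> h; apply/row_subP => i; rewrite /rows_in row_rowsub; apply: h.
exact: enum_valP.
Qed.

Lemma rows_inS n p (X : 'M[F]_(n, p)) (S T : {set 'I_n}) :
  S \subset T -> (rows_in X S <= rows_in X T)%MS.
Proof. by move=> /fintype.subsetP ST; apply: rows_in_sub => j /ST; exact: row_rows_in. Qed.

Lemma rows_in_submx n p (X : 'M[F]_(n, p)) (S : {set 'I_n}) : (rows_in X S <= X)%MS.
Proof. by rewrite rows_inE submxMl. Qed.

Lemma rows_in_mul0 n p q (X : 'M[F]_(n, p)) (S : {set 'I_n}) (x : 'M[F]_(p, q)) :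
  (rows_in X S *m x == 0) = [forall j in S, row j (X *m x) == 0].
Proof.
apply/eqP/forall_inP => [h j jS|h].
  have := submxMr x (row_rows_in X jS).
  by rewrite h => /submx0null; rewrite row_mul => ->.
apply/row_matrixP => i; rewrite row_mul /rows_in row_rowsub row0 -row_mul.
by apply/eqP/h/enum_valP.
Qed.

Lemma sub_zero_rows n p (X : 'M[F]_(n, p)) (S : {set 'I_n}) (x : 'cV[F]_p) :
  (S \subset zero_rows X x) = (rows_in X S *m x == 0).
Proof.
rewrite rows_in_mul0; apply/fintype.subsetP/forall_inP => h j jS.
  have := h j jS; rewrite inE => /eqP e; apply/eqP/rowP => i.
  by rewrite ord1 [LHS]mxE e mxE.
rewrite inE; have /eqP/rowP/(_ 0) := h j jS.
by rewrite [LHS]mxE => ->; rewrite mxE.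
Qed.

Lemma rows_indep_free k n p (X : 'M[F]_(n, p)) (S : {set 'I_n}) :
  rows_indep k X -> (#|S| <= k)%N -> row_free (rows_in X S).
Proof.
move=> indX Sk; rewrite -kermx_eq0; apply/rowV0P => w /sub_kermxP.
rewrite rows_inE mulmxA => /(indX _ (leq_trans (subset_leq_card _) Sk)) w0.
by apply/rows_in_coords/w0/row_support_rows_in.
Qed.

Lemma rows_indep_rank k n p (X : 'M[F]_(n, p)) (S : {set 'I_n}) :
  rows_indep k X -> (#|S| <= k)%N -> \rank (rows_in X S) = #|S|.
Proof. by move=> indX /(rows_indep_free indX)/eqP. Qed.

Lemma rows_indep_neq0 k n p (X : 'M[F]_(n, p)) j :
  rows_indep k X -> (0 < k)%N -> row j X != 0.
Proof.
move=> indX k0; apply/eqP; rewrite rowE => /indX; rewrite row_support_delta cards1.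
by move=> /(_ k0)/rowP/(_ j); rewrite !mxE !eqxx => /eqP; rewrite oner_eq0.
Qed.

(** The two coefficient vectors of [v] differ by a vector supported in [S] together with [a] and
    [b], so on at most [k] indices; hence they are equal, with support in both sets, which meet in
    [S]. *)
Lemma rows_in_meet k n p (X : 'M[F]_(n, p)) (S : {set 'I_n}) a b (v : 'rV_p) :
  rows_indep k X -> (#|S|.+2 <= k)%N -> a != b ->
  (v <= rows_in X (a |: S))%MS -> (v <= rows_in X (b |: S))%MS ->
  (v <= rows_in X S)%MS.
Proof.
move=> indX Sk ab /sub_rows_inP[u uS ->] /sub_rows_inP[w wS uw].
have /eqP : u - w = 0.
  apply: indX; last by rewrite mulmxBl uw subrr.
  have sub : row_support (u - w) \subset a |: (b |: S).
    apply/fintype.subsetP => j; rewrite inE !mxE => uwj.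
    have : (u 0 j != 0) || (w 0 j != 0).
      apply: contraNT uwj; rewrite negb_or !negbK => /andP[/eqP-> /eqP->].
      by rewrite subr0.
    case/orP => [uj|wj].
      have : j \in a |: S by apply: (fintype.subsetP uS); rewrite inE.
      by rewrite !inE => /orP[->|->]; rewrite ?orbT.
    have : j \in b |: S by apply: (fintype.subsetP wS); rewrite inE.
    by rewrite !inE => ->; rewrite orbT.
  apply: leq_trans (subset_leq_card sub) _; apply: leq_trans Sk.
  rewrite !cardsU1; case: (_ \notin _); case: (_ \notin _);
    by rewrite /= ?add0n ?add1n; lia.
rewrite subr_eq0 => /eqP e; apply/sub_rows_inP; exists u => //.
apply/fintype.subsetP => j ju; have := fintype.subsetP uS _ ju; rewrite e in ju.
have := fintype.subsetP wS _ ju; rewrite !inE => /orP[/eqP->|->]; rewrite ?orbT//.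
by rewrite eq_sym (negbTE ab).
Qed.

Lemma exists_superset n (S : {set 'I_n}) k : (#|S| <= k <= n)%N ->
  exists2 T : {set 'I_n}, S \subset T & #|T| = k.
Proof.
move=> /andP[Sk kn]; elim: k Sk kn => [|k IH] Sk kn.
  by exists S => //; apply/eqP; rewrite -leqn0.
have [e|ne] := eqVneq #|S| k.+1; first by exists S.
have [||T ST Tk] := IH; try lia.
have /set0Pn[a] : ~: T != finset.set0.
  by rewrite -card_gt0; have := cardsC T; rewrite card_ord; lia.
rewrite inE => aT; exists (a |: T); last by rewrite cardsU1 aT Tk.
by apply: fintype.subset_trans ST _; apply: finset.subsetUr.
Qed.

Lemma exists_subset n (S : {set 'I_n}) k : (k <= #|S|)%N ->
  exists2 T : {set 'I_n}, T \subset S & #|T| = k.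
Proof.
move=> kS; have kn : (#|S| <= n)%N by have := max_card (mem S); rewrite card_ord.
have [|T ST Tk] := @exists_superset n (~: S) (n - k).
  by have := cardsC S; rewrite card_ord; lia.
exists (~: T); first by rewrite -[S]finset.setCK finset.setCS.
by have := cardsC T; rewrite card_ord; lia.
Qed.

Lemma exists_two_outside n (S : {set 'I_n}) : (#|S|.+2 <= n)%N ->
  exists a b, [/\ a != b, a \notin S & b \notin S].
Proof.
move=> Sn; have /card_gt1P[a [b [aS bS ab]]] : (1 < #|~: S|)%N.
  by have := cardsC S; rewrite card_ord; lia.
by exists a, b; split => //; [rewrite inE in aS|rewrite inE in bS].
Qed.

End RowFamilies.

(** * Kruskal's permutation lemma *)

Section PermutationLemma.
Variables (F : fieldType) (k n p : nat) (X Y : 'M[F]_(n, p)).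
Hypotheses (k_gt1 : (1 < k)%N) (kn : (k <= n)%N).
Hypotheses (indX : rows_indep k X) (rkX : (\rank X <= k)%N).
Hypothesis rkY : (\rank Y <= k)%N.
(** Kruskal's condition, with zeros counted instead of nonzero entries: [k.-1] zeros of [Y *m x]
    mean a weight of at most [n - k + 1]. *)
Hypothesis zXY : forall x, (k.-1 <= #|zero_rows Y x|)%N ->
  (#|zero_rows Y x| <= #|zero_rows X x|)%N.

(** Any [k] rows of [X] span its whole row space, so an [x] killed by [k] of them is killed by
    all. *)
Lemma zero_rows_lt x : X *m x != 0 -> (#|zero_rows X x| < k)%N.
Proof.
apply: contraNT; rewrite -leqNgt => /exists_subset[T Tz Tk].
have /eqP : \rank (rows_in X T) = \rank X.
  by apply/eqP; rewrite eqn_leq mxrankS ?rows_in_submx//= (rows_indep_rank indX) Tk.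
rewrite (mxrank_leqif_sup (rows_in_submx X T)) => /submxP[D ->].
by rewrite -mulmxA; move: Tz; rewrite sub_zero_rows => /eqP->; rewrite mulmx0.
Qed.

(** For a column [x] of [cokermx Y], all [n >= k] entries of [Y *m x] vanish, hence also those of
    [X *m x]. *)
Lemma permuted_sub : (X <= Y)%MS.
Proof.
rewrite submxE; apply/eqP/trmx_inj/row_matrixP => i; rewrite -tr_col trmx0 row0.
apply: (can_inj trmxK); rewrite trmxK trmx0 colE -mulmxA -colE.
set x := col i _; have Yx : Y *m x = 0 by rewrite /x colE mulmxA mulmx_coker mul0mx.
have zY : zero_rows Y x = [set: 'I_n].
  by apply/setP => j; rewrite !inE Yx mxE eqxx.
have := @zXY x; rewrite zY cardsT card_ord => /(_ ltac:(lia)) nz.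
apply/eqP; apply: contraTT (leq_trans kn nz) => /zero_rows_lt.
by rewrite -ltnNge.
Qed.

Lemma permuted_rank : \rank X = k /\ \rank Y = k.
Proof.
have [T _ Tk] : exists2 T : {set 'I_n}, finset.set0 \subset T & #|T| = k.
  by apply: exists_superset; rewrite cards0.
have := mxrankS (rows_in_submx X T).
rewrite (rows_indep_rank indX) Tk// => h1.
have h2 := leq_trans h1 (mxrankS permuted_sub).
by split; apply/eqP; rewrite eqn_leq ?h1 ?h2 ?rkX ?rkY.
Qed.

(** Fewer than [k] rows of [Y] cannot span the row space of [X], of dimension [k], so [X] does not
    kill the cokernel of those rows. *)
Lemma exists_annihilator (S : {set 'I_n}) : (#|S| < k)%N ->
  exists x : 'cV[F]_p, rows_in Y S *m x = 0 /\ X *m x != 0.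
Proof.
move=> Sk; have : ~~ (X <= rows_in Y S)%MS.
  apply: contraL Sk => /mxrankS; rewrite permuted_rank.1 -leqNgt => h.
  exact: leq_trans h (rank_leq_row _).
rewrite submxE => h.
have [i hi] : exists i, X *m col i (cokermx (rows_in Y S)) != 0.
  apply/existsP; apply: contraNT h => /existsPn h.
  apply/eqP/trmx_inj/row_matrixP => i; rewrite -tr_col trmx0 row0.
  apply: (can_inj trmxK); rewrite trmxK trmx0 colE -mulmxA -colE.
  by apply/eqP; have := h i; rewrite negbK.
exists (col i (cokermx (rows_in Y S))); split => //.
by rewrite colE mulmxA mulmx_coker mul0mx.
Qed.

(** The chain [k.-1 = #|S| <= #|zero_rows Y x| <= #|zero_rows X x| < k] collapses. *)
Lemma annihilator_zero_rows (S : {set 'I_n}) x : #|S| = k.-1 ->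
  rows_in Y S *m x = 0 -> X *m x != 0 ->
  zero_rows Y x = S /\ #|zero_rows X x| = k.-1.
Proof.
move=> Sk /eqP; rewrite -sub_zero_rows => Sz Xx.
have h0 := subset_leq_card Sz; have h1 := zXY (leq_trans (eq_leq (esym Sk)) h0).
have h2 := zero_rows_lt Xx; split; last lia.
by apply/eqP; rewrite eq_sym eqEcard Sz; lia.
Qed.

(** If a dependency [u] supported in a [k]-set [T] has [u 0 j != 0], take [x] such that, on [T],
    [Y *m x] is nonzero only at [j]: pairing [u *m Y] with [x] leaves one nonzero term. *)
Lemma permuted_indep : rows_indep k Y.
Proof.
move=> u uk uY; apply/eqP; apply: contraT => u0.
have [j uj] : exists j, u 0 j != 0.
  by apply/existsP; apply: contraNT u0 => /existsPn h; apply/eqP/rowP => j;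
    rewrite mxE; apply/eqP; have := h j; rewrite negbK.
have [|T uT Tk] := @exists_superset _ (row_support u) k; first by rewrite uk.
have jT : j \in T by apply: (fintype.subsetP uT); rewrite inE.
have Tjk : #|T :\ j| = k.-1 by have := cardsD1 j T; rewrite jT Tk => ->.
have [|x [Yx Xx]] := @exists_annihilator (T :\ j); first by lia.
have [zY _] := annihilator_zero_rows Tjk Yx Xx.
have : j \notin zero_rows Y x by rewrite zY !inE eqxx.
rewrite inE; have : (u *m (Y *m x)) 0 0 = 0 by rewrite mulmxA uY mul0mx mxE.
rewrite mxE (bigD1 j)//= big1 => [|i ij].
  by rewrite addr0 => /eqP; rewrite mulf_eq0 (negbTE uj) /= => ->.
have [iT|iT] := boolP (i \in T).
  have : i \in zero_rows Y x by rewrite zY !inE ij.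
  by rewrite inE => /eqP->; rewrite mulr0.
have : i \notin row_support u by apply: contra iT; apply: (fintype.subsetP uT).
by rewrite inE negbK => /eqP->; rewrite mul0r.
Qed.

(** For a singleton [S] this set will turn out to be a singleton, which defines the permutation;
    sizes are settled downwards from [#|S| = k.-1]. *)
Let rows_inside (S : {set 'I_n}) := [set j | row j X <= rows_in Y S]%MS.

Lemma card_rows_inside (S : {set 'I_n}) : (#|S| < k)%N -> (#|rows_inside S| <= #|S|)%N.
Proof.
move=> Sk; rewrite leqNgt; apply/negP => /exists_subset[T TS Tk].
have : (rows_in X T <= rows_in Y S)%MS.
  by apply: rows_in_sub => j /(fintype.subsetP TS); rewrite inE.
move=> /mxrankS; rewrite (rows_indep_rank indX) ?Tk//.
by move=> /leq_trans/(_ (rank_leq_row _)); rewrite ltnn.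
Qed.

(** Some [x] is killed by exactly the rows [S] of [Y] and by [k.-1] rows of [X]. Such a row of [X],
    expanded over the basis [a |: S] of the row space of [Y], has coefficient zero at [a], as
    pairing with [x] shows. *)
Lemma hyperplane_rows_inside (S : {set 'I_n}) : #|S| = k.-1 -> #|rows_inside S| = #|S|.
Proof.
move=> Sk; have Slt : (#|S| < k)%N by lia.
apply/eqP; rewrite eqn_leq card_rows_inside//=.
have [x [Yx Xx]] := exists_annihilator Slt.
have [zY zX] := annihilator_zero_rows Sk Yx Xx.
rewrite Sk -zX; apply/subset_leq_card/fintype.subsetP => j; rewrite !inE => /eqP jx.
have [a aS] : exists a, a \notin S.
  have /set0Pn[a] : ~: S != finset.set0.
    by rewrite -card_gt0; have := cardsC S; rewrite card_ord; lia.
  by rewrite inE; exists a.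
have aSk : #|a |: S| = k by rewrite cardsU1 aS Sk; lia.
have YaS : (Y <= rows_in Y (a |: S))%MS.
  rewrite -(mxrank_leqif_sup (rows_in_submx Y _)).
  by rewrite (rows_indep_rank permuted_indep) aSk// permuted_rank.2.
have /sub_rows_inP[u uS jE] := submx_trans (submx_trans (row_sub j X) permuted_sub) YaS.
rewrite jE; apply/sub_rows_inP; exists u => //; apply/fintype.subsetP => i ui.
have := fintype.subsetP uS _ ui; rewrite in_setU1 => /orP[/eqP ia|//].
have : (u *m (Y *m x)) 0 0 = 0.
  by rewrite mulmxA -jE -row_mul mxE jx.
rewrite mxE (bigD1 a)//= big1 => [|l la].
  move/eqP; rewrite addr0 mulf_eq0; move: ui; rewrite inE ia => /negbTE->/=.
  have : a \notin zero_rows Y x by rewrite zY.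
  by rewrite inE => /negbTE->.
have [lS|lS] := boolP (l \in S).
  have : l \in zero_rows Y x by rewrite zY.
  by rewrite inE => /eqP->; rewrite mulr0.
have : l \notin row_support u.
  by apply: contra lS => /(fintype.subsetP uS); rewrite !inE (negbTE la).
by rewrite inE negbK => /eqP->; rewrite mul0r.
Qed.

(* The spans of [a |: S], for [a] outside [S], meet pairwise in the span of [S],
   so each row of X outside the latter lies in at most one of them. *)
Lemma card_rows_inside_eq (S : {set 'I_n}) : (0 < #|S| < k)%N -> #|rows_inside S| = #|S|.
Proof.
have [h] := ubnP (k - #|S|)%N; elim: h S => // h IH S hS /andP[S0 Sk].
have [Sk1|Sk1] := eqVneq #|S| k.-1; first exact: hyperplane_rows_inside.
set g := #|rows_inside S|; have gS : (g <= #|S|)%N by exact: card_rows_inside.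
pose D a := rows_inside (a |: S) :\: rows_inside S.
have sub a : rows_inside S \subset rows_inside (a |: S).
  apply/fintype.subsetP => j; rewrite !inE => /submx_trans; apply; apply: rows_inS.
  exact: finset.subsetUr.
have cD a : a \notin S -> #|D a| = (#|S|.+1 - g)%N.
  move=> aS; rewrite cardsD (finset.setIidPr (sub a)) IH cardsU1 aS ?add1n//; lia.
have : (\sum_(a | a \notin S) #|D a| <= #|~: rows_inside S|)%N.
  under eq_bigr do rewrite -sum1_card big_mkcond /=.
  rewrite exchange_big /= -sum1_card [leqRHS]big_mkcond /=; apply: leq_sum => j _.
  rewrite finset.in_setC; have [jS|jS] := ifPn.
    rewrite leqNgt; apply/negP.
    rewrite -big_mkcondr sum1_card /= => /card_gt1P[a [b [ha hb ab]]].
    move: ha hb; rewrite -!topredE /= /D !inE.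
    move=> /andP[aS /andP[_ ja]] /andP[bS /andP[_ jb]].
    move/negP: jS; apply; rewrite ?inE.
    by apply: (rows_in_meet permuted_indep _ ab ja jb); lia.
  by move: jS; rewrite negbK => jS; rewrite big1// => a _; rewrite /D finset.in_setD jS.
under eq_bigr => a aS do rewrite cD//.
rewrite sum_nat_const.
have -> : #|[pred a | a \notin S]| = (n - #|S|)%N.
  rewrite (_ : #|[pred a | a \notin S]| = #|~: S|).
    by have := cardsC S; rewrite card_ord; lia.
  by apply: eq_card => a; rewrite !inE.
have -> : #|~: rows_inside S| = (n - g)%N.
  by have := cardsC (rows_inside S); rewrite card_ord -/g; lia.
(* With [s = #|S|] the count reads [(n - s) * (s + 1 - g) <= n - g]. If [g < s], put
   [n - s = q + 2], possible as [s < k - 1] and [k <= n], and [s = g + t + 1]: then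
   [(q + 2) * (t + 2) <= q + t + 3], which is false. *)
move=> le; apply/eqP; rewrite eqn_leq gS /= leqNgt; apply/negP => lt.
have [q qE] : exists q, (n - #|S|)%N = q.+2.
  exists (n - #|S| - 2)%N.
  have : (#|S| < k.-1)%N by rewrite ltn_neqAle Sk1 -ltnS prednK//; lia.
  by lia.
have [t tE] : exists t, (#|S| = g + t.+1)%N.
  by exists (#|S| - g.+1)%N; rewrite -addSnnS subnKC.
rewrite tE in le qE; rewrite qE in le.
have e1 : ((g + t.+1).+1 - g = t.+2)%N by lia.
have e2 : (n - g = q.+2 + t.+1)%N by lia.
by move: le; rewrite e1 e2; nia.
Qed.

(** For singletons, [card_rows_inside_eq] matches each row of [Y] with one row of [X]. Two rows of
    [Y] matched with the same one would be proportional, against [permuted_indep] since [k > 1]. *)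
Lemma permutation_lemma :
  exists s : {perm 'I_n}, exists c : 'I_n -> F,
    forall j, c j != 0 /\ row j Y = c j *: row (s j) X.
Proof.
have ex j : exists l, exists c, c != 0 /\ row j Y = c *: row l X.
  have : #|rows_inside [set j]| = #|[set j]|.
    by apply: card_rows_inside_eq; rewrite cards1; lia.
  rewrite cards1 => /eqP/cards1P[l lE]; exists l.
  have : l \in rows_inside [set j] by rewrite lE inE.
  rewrite inE => h; have /sub_rVP[c cE] : (row l X <= row j Y)%MS.
    apply: submx_trans h _; apply: rows_in_sub => i; rewrite inE => /eqP->.
    exact: submx_refl.
  have c0 : c != 0.
    apply: contra_neq (rows_indep_neq0 l indX (ltnW k_gt1)) => c0.
    by rewrite cE c0 scale0r.
  exists c^-1; split; first by rewrite invr_eq0.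
  by rewrite cE scalerA mulVf// scale1r.
have [s sE] := fin_all_exists ex; have [c cE] := fin_all_exists sE.
have sinj : injective s.
  move=> i j sij; apply/eqP; apply: contraT => ij.
  have [ci Yi] := cE i; have [cj Yj] := cE j.
  pose u : 'rV[F]_n := c j *: delta_mx 0 i - c i *: delta_mx 0 j.
  have : u = 0.
    apply: permuted_indep; last first.
      by rewrite mulmxBl -!scalemxAl -!rowE Yi Yj sij !scalerA mulrC subrr.
    have sub : row_support u \subset [set i; j].
      apply/fintype.subsetP => l; rewrite !inE !mxE eqxx /=.
      by case: (l == i); case: (l == j); rewrite // !mulr0 subrr eqxx.
    by apply: leq_trans (subset_leq_card sub) _; rewrite cards2 ij.
  move=> /rowP/(_ i); rewrite !mxE !eqxx (negbTE ij) /= mulr1 mulr0 subr0.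
  by move=> cj0; rewrite cj0 eqxx in cj.
by exists (perm sinj), c => j; rewrite permE.
Qed.

End PermutationLemma.

(** * Cauchy-Binet and compound matrices *)

Section LexSubsets.
Variables k p : nat.
Implicit Type i : 'I_'C(p, k).

Lemma lex_ksubset_sorted i : sorted ltn [seq val x | x <- lex_ksubset i].
Proof. by have := Order.enum_valP (cast_ord (esym (card_ksubset k p)) i). Qed.

Lemma lex_ksubset_inj : injective (@lex_ksubset k p).
Proof.
move=> i j ij; apply: (@cast_ord_inj _ _ (esym (card_ksubset k p))).
exact: (@Order.enum_val_inj _ _ (@ksubset k p) _ _ ij).
Qed.

Lemma tnth_lex_ksubset_inj i : injective (tnth (lex_ksubset i)).
Proof.
apply/injectiveP; rewrite /injectiveb /dinjectiveb map_tnth_enum -(map_inj_uniq val_inj).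
exact: sorted_uniq ltn_trans ltnn _ (lex_ksubset_sorted i).
Qed.

Lemma lex_ksubset_eq i j : lex_ksubset i =i lex_ksubset j -> i = j.
Proof.
move=> ij; apply: lex_ksubset_inj; apply: val_inj => /=.
apply: (inj_map (@ord_inj p)).
apply: (irr_sorted_eq ltn_trans ltnn); try exact: lex_ksubset_sorted.
by move=> x; apply/mapP/mapP => -[y yi ->]; exists y => //; rewrite ?ij// -ij.
Qed.

Lemma lex_ksubset_of_set (T : {set 'I_p}) : #|T| = k ->
  exists i, lex_ksubset i =i T.
Proof.
move=> Tk; have eT : size (enum T) == k by rewrite -cardE Tk.
have sT : (Tuple eT : k.-tuplelexi 'I_p) \in @ksubset k p.
  rewrite inE /= sorted_map /enum_mem; apply: sorted_filter.
    by move=> x y z; apply: ltn_trans.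
  by rewrite -enumT -sorted_map val_enum_ord iota_ltn_sorted.
exists (cast_ord (card_ksubset k p) (Order.enum_rank_in sT (Tuple eT))) => x.
by rewrite /lex_ksubset cast_ordK Order.enum_rankK_in// mem_enum.
Qed.

End LexSubsets.

Section CauchyBinet.
Variable F : fieldType.

(** The expansion is that of the multiplicativity of determinants, with index maps into ['I_n]; a
    map that is not injective repeats a row of [Q] and contributes zero. *)
Lemma det_mulmx_inj m n (P : 'M[F]_(m, n)) (Q : 'M[F]_(n, m)) :
  \det (P *m Q) = \sum_(f : {ffun 'I_m -> 'I_n} | injectiveb f)
    (\prod_i P i (f i)) * \det (rowsub f Q).
Proof.
pose PQ (s : 'S_m) i j := P i j * Q j (s i).
transitivity (\sum_(f : {ffun 'I_m -> 'I_n}) \sum_(s : 'S_m)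
    (-1) ^+ s * \prod_i PQ s i (f i)).
  rewrite exchange_big; apply: eq_bigr => /= s _; rewrite -big_distrr /=.
  congr (_ * _); rewrite -(bigA_distr_bigA (PQ s)) /=.
  by apply: eq_bigr => x _; rewrite mxE.
have E (f : {ffun 'I_m -> 'I_n}) :
    \sum_(s : 'S_m) (-1) ^+ s * \prod_i PQ s i (f i)
    = (\prod_i P i (f i)) * \det (rowsub f Q).
  rewrite big_distrr /=; apply: eq_bigr => s _.
  rewrite mulrCA big_split //=; congr (_ * (_ * _)).
  by apply: eq_bigr => x _; rewrite mxE.
under eq_bigr do rewrite E.
rewrite (bigID (fun f : {ffun 'I_m -> 'I_n} => injectiveb f)) /= addrC big1 ?add0r//.
move=> f /injectivePn[i1 [i2 Di12 Ef12]].
by rewrite (determinant_alternate Di12) ?mulr0// => j; rewrite !mxE Ef12.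
Qed.

(* Every injection from a k-set is uniquely a permutation followed by an
   increasing one; surjectivity of the parametrization is by cardinality. *)
Lemma cauchy_binet m n (P : 'M[F]_(m, n)) (Q : 'M[F]_(n, m)) :
  \det (P *m Q) = \sum_(j < 'C(n, m))
    \det (colsub (tnth (lex_ksubset j)) P) * \det (rowsub (tnth (lex_ksubset j)) Q).
Proof.
pose h (js : 'I_'C(n, m) * 'S_m) := [ffun i => tnth (lex_ksubset js.1) (js.2 i)].
have hinj : injective h.
  move=> [j s] [j' s'] hE; have hE' i : tnth (lex_ksubset j) (s i)
      = tnth (lex_ksubset j') (s' i).
    by have := congr1 (fun f : {ffun _ -> _} => f i) hE; rewrite !ffunE.
  have jj : j = j'.
    apply: lex_ksubset_eq => x; apply/tnthP/tnthP => -[i ->].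
      by exists (s' (s^-1%g i)); rewrite -hE' permKV.
    by exists (s (s'^-1%g i)); rewrite hE' permKV.
  rewrite -jj in hE' *; congr pair; apply/permP => i.
  exact: tnth_lex_ksubset_inj (hE' i).
have him : h @: [set: 'I_'C(n, m) * 'S_m] =
    [set f : {ffun 'I_m -> 'I_n} | injectiveb f].
  apply/eqP; rewrite eqEcard; apply/andP; split.
    apply/fintype.subsetP => _ /imsetP[[j s] _ ->]; rewrite inE; apply/injectiveP => i i'.
    by rewrite !ffunE => /tnth_lex_ksubset_inj/perm_inj.
  by rewrite card_imset// cardsT card_prod card_ord card_Sn card_inj_ffuns
    !card_ord bin_ffact.
rewrite det_mulmx_inj -big_set -him big_imset; last by move=> x y _ _; apply: hinj.
rewrite big_set /= -(pair_bigA _ (fun j s => (\prod_i P i (h (j, s) i))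
   * \det (rowsub (h (j, s)) Q))) /=.
apply: eq_bigr => j _; rewrite [\det (colsub _ P)]/determinant mulr_suml.
apply: eq_bigr => s _.
have -> : rowsub (h (j, s)) Q = perm_mx s *m rowsub (tnth (lex_ksubset j)) Q.
  by rewrite -row_permE; apply/matrixP => a b; rewrite !mxE ffunE.
rewrite det_mulmx det_perm mulrCA mulrA; congr (_ * _ * _).
by apply: eq_bigr => i _; rewrite mxE ffunE.
Qed.

(** A dependency supported in [T], read only in the columns [g], is a square system with invertible
    matrix, so its coefficients vanish. *)
Lemma minors_indep k n p (X : 'M[F]_(n, p)) : (k <= n)%N ->
  (forall T : {set 'I_n}, #|T| = k ->
    exists f : 'I_k -> 'I_n, exists g : 'I_k -> 'I_p,
    [/\ injective f, T \subset codom f & \det (mxsub f g X) != 0]) ->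
  rows_indep k X.
Proof.
move=> kn h u uk uX.
have [|T uT Tk] := @exists_superset _ (row_support u) k; first by rewrite uk.
have [f [g [finj Tf dX]]] := h T Tk.
have w0 : \row_i u 0 (f i) = 0.
  apply: (row_free_inj (A := mxsub f g X)).
    by rewrite row_free_unit unitmxE unitfE.
  rewrite mul0mx; apply/rowP => l; rewrite [RHS]mxE.
  transitivity ((u *m X) 0 (g l)); last by rewrite uX mxE.
  rewrite !mxE.
  rewrite [RHS](bigID (mem (f @: [set: 'I_k]))) /= [X in _ = _ + X]big1 ?addr0.
    rewrite big_imset; last by move=> x y _ _; apply: finj.
    by apply: eq_big => [i|i _]; rewrite ?inE ?mxE.
  move=> s sf; have : s \notin row_support u.
    apply: contra sf => /(fintype.subsetP uT)/(fintype.subsetP Tf)/codomP[i ->].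
    exact: imset_f.
  by rewrite inE negbK => /eqP->; rewrite mul0r.
apply/rowP => s; rewrite mxE; apply/eqP; apply: contraT => us.
have : s \in T by apply: (fintype.subsetP uT); rewrite inE.
move=> /(fintype.subsetP Tf)/codomP[i si]; move/rowP/(_ i): w0; rewrite !mxE -si.
by move=> /eqP; rewrite (negbTE us).
Qed.

(** Cauchy-Binet across the diagonal factor, which only weights each term by the product of [d] over
    the chosen index set. *)
Lemma compound_mul_diag k p q n (A : 'M[F]_(p, n)) (B : 'M[F]_(q, n)) (d : 'rV_n)
    (i : 'I_'C(p, k)) (l : 'I_'C(q, k)) :
  \det (mxsub (tnth (lex_ksubset i)) (tnth (lex_ksubset l)) (A *m diag_mx d *m B^T))
  = \sum_(j < 'C(n, k)) compound k A i j * compound k B l j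
      * \prod_(x < k) d 0 (tnth (lex_ksubset j) x).
Proof.
set a := tnth _; set b := tnth _.
have -> : mxsub a b (A *m diag_mx d *m B^T) = rowsub a (A *m diag_mx d) *m colsub b B^T.
  by apply/matrixP => x y; rewrite !mxE; apply: eq_bigr => s _; rewrite !mxE.
rewrite cauchy_binet; apply: eq_bigr => j _; set t := tnth (lex_ksubset j).
have -> : rowsub t (colsub b B^T) = (mxsub b t B)^T.
  by apply/matrixP => x y; rewrite !mxE.
have -> : colsub t (rowsub a (A *m diag_mx d)) =
    mxsub a t A *m diag_mx (\row_x d 0 (t x)).
  by apply/matrixP => x y; rewrite !mul_mx_diag !mxE.
rewrite det_tr det_mulmx det_diag !mxE mulrAC; congr (_ * _).
by apply: eq_bigr => x _; rewrite mxE.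
Qed.

(** * Consequences of a Khatri-Rao product of compounds with full column rank *)

Section FullKhatriRao.
Variables (k p q n : nat) (A : 'M[F]_(p, n)) (B : 'M[F]_(q, n)).
Hypothesis fullAB : compound_khatri_rao_full k A B.

Lemma compound_khatri_rao_mul0 (w : 'cV[F]_'C(n, k)) :
  khatri_rao (compound k A) (compound k B) *m w = 0 -> w = 0.
Proof.
have [_ _ /row_fullP[M MK]] := fullAB => e.
by rewrite -[w]mul1mx -MK -mulmxA e mulmx0.
Qed.

(** The [k]-minors on the left are the entries of the Khatri-Rao product applied to the vector [w]
    of products of [d] over [k]-sets. Those on the right vanish, as every [k]-set meets a zero of
    [d']. So [w = 0], and [d] cannot have [k] nonzero entries. *)
Lemma khatri_rao_weight (A' : 'M[F]_(p, n)) (B' : 'M[F]_(q, n)) (d d' : 'rV_n) :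
  A *m diag_mx d *m B^T = A' *m diag_mx d' *m B'^T ->
  (#|row_support d'| < k)%N -> (#|row_support d| < k)%N.
Proof.
move=> AB d'k; rewrite ltnNge; apply/negP => /exists_subset[T Td Tk].
have [j jT] := lex_ksubset_of_set Tk.
pose w : 'cV[F]_'C(n, k) := \col_j \prod_(x < k) d 0 (tnth (lex_ksubset j) x).
have w0 : w = 0.
  apply: compound_khatri_rao_mul0; apply/colP => y; rewrite mxE [RHS]mxE.
  transitivity (\det (mxsub (tnth (lex_ksubset (mxtens_unindex y).1))
       (tnth (lex_ksubset (mxtens_unindex y).2)) (A *m diag_mx d *m B^T))).
    by rewrite compound_mul_diag; apply: eq_bigr => x _; rewrite !mxE.
  rewrite AB compound_mul_diag big1// => l _.
  suff [x /eqP dx] : exists x, d' 0 (tnth (lex_ksubset l) x) == 0.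
    by rewrite (bigD1 x)//= dx mul0r mulr0.
  apply/existsP; apply: contraTT d'k => /existsPn dx; rewrite -leqNgt.
  rewrite -[k in (k <= _)%N]card_ord -(card_codom (@tnth_lex_ksubset_inj _ _ l)).
  by apply/subset_leq_card/fintype.subsetP => _ /codomP[x ->]; rewrite inE dx.
have /eqP : w j 0 = 0 by rewrite w0 mxE.
rewrite mxE => /eqP/eqP/prodf_eq0[x _] /eqP dx.
have : tnth (lex_ksubset j) x \in row_support d.
  by apply: (fintype.subsetP Td); rewrite -jT mem_tnth.
by rewrite inE dx eqxx.
Qed.

(** No column of the Khatri-Rao product is zero, so neither compound has a zero column: any [k]
    columns of [A], or of [B], carry a nonzero [k]-minor. *)
Lemma khatri_rao_indep : rows_indep k A^T /\ rows_indep k B^T.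
Proof.
have [kpn kqn _] := fullAB.
have col0 (j : 'I_'C(n, k)) : exists i l, compound k A i j != 0 /\ compound k B l j != 0.
  have : khatri_rao (compound k A) (compound k B) *m delta_mx j 0 != 0 :> 'cV_ _.
    apply/eqP => /compound_khatri_rao_mul0/colP/(_ j).
    by rewrite !mxE !eqxx => /eqP; rewrite oner_eq0.
  rewrite -colE => /cV0Pn[y]; rewrite !mxE mulf_eq0 negb_or => /andP[Ay By].
  by exists (mxtens_unindex y).1, (mxtens_unindex y).2; rewrite !mxE.
split; (apply: minors_indep; first lia) => T /lex_ksubset_of_set[j jT];
  have [i [l]] := col0 j; rewrite !mxE => -[Aij Blj].
- exists (tnth (lex_ksubset j)), (tnth (lex_ksubset i)); split.
  + exact: tnth_lex_ksubset_inj.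
  + by apply/fintype.subsetP => s; rewrite -jT => /tnthP[x ->]; apply: codom_f.
  + by rewrite -trmx_mxsub det_tr.
- exists (tnth (lex_ksubset j)), (tnth (lex_ksubset l)); split.
  + exact: tnth_lex_ksubset_inj.
  + by apply/fintype.subsetP => s; rewrite -jT => /tnthP[x ->]; apply: codom_f.
  + by rewrite -trmx_mxsub det_tr.
Qed.

End FullKhatriRao.

End CauchyBinet.

(** * Uniqueness for a given decomposition *)

Section Uniqueness.
Variable F : fieldType.

Lemma tr_mul_diag p q n (A : 'M[F]_(p, n)) (B : 'M[F]_(q, n)) (d : 'rV_n) :
  (A *m diag_mx d *m B^T)^T = B *m diag_mx d *m A^T.
Proof. by rewrite !trmx_mul trmxK tr_diag_mx mulmxA. Qed.

Lemma mul_diag_rows_in p q n (A : 'M[F]_(p, n)) (B : 'M[F]_(q, n)) (d : 'rV_n)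
    (S : {set 'I_n}) : row_support d \subset S ->
  A *m diag_mx d *m B^T = (rows_in A^T S)^T
    *m diag_mx (\row_i d 0 (enum_val (i : 'I_#|S|))) *m rows_in B^T S.
Proof.
move=> dS; apply/matrixP => i l; rewrite !mul_mx_diag [LHS]mxE [RHS]mxE.
transitivity (\sum_(s in S) A i s * d 0 s * B l s).
  rewrite [LHS](bigID (mem S)) /= [X in _ + X]big1 ?addr0.
    by apply: eq_bigr => s _; rewrite !mxE.
  move=> s sS; have : s \notin row_support d by apply: contra sS; apply: (fintype.subsetP dS).
  by rewrite inE negbK !mxE => /eqP->; rewrite mulr0 mul0r.
by rewrite big_enum_val; apply: eq_bigr => s _; rewrite !mxE.
Qed.

Lemma rank_mul_diag_le p q n (A : 'M[F]_(p, n)) (B : 'M[F]_(q, n)) (d : 'rV_n) :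
  (\rank (A *m diag_mx d *m B^T) <= #|row_support d|)%N.
Proof. by rewrite (mul_diag_rows_in _ _ (subxx _)) mulmx_max_rank. Qed.

(** Cut down to the support of [d], the three factors have full column rank, are invertible, and
    have full row rank, respectively. *)
Lemma rank_mul_diag k p q n (A : 'M[F]_(p, n)) (B : 'M[F]_(q, n)) (d : 'rV_n) :
  rows_indep k A^T -> rows_indep k B^T -> (#|row_support d| <= k)%N ->
  \rank (A *m diag_mx d *m B^T) = #|row_support d|.
Proof.
move=> indA indB dk; rewrite (mul_diag_rows_in _ _ (subxx _)).
rewrite mxrankMfree ?(rows_indep_free indB)// mxrankMfree.
  by rewrite mxrank_tr (rows_indep_rank indA).
rewrite row_free_unit unitmxE det_diag unitfE; apply/prodf_neq0 => i _.
by rewrite mxE; have := enum_valP i; rewrite inE.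
Qed.

(** The column space of the common slice lies in the spans of the supported columns of [A] and of
    [A']. Its dimension is the size of the support, so it exhausts the span for [A']. *)
Lemma diag_eq_sub_rows_in k p q n (A A' : 'M[F]_(p, n)) (B B' : 'M[F]_(q, n)) (d : 'rV_n) j :
  rows_indep k A^T -> rows_indep k B^T -> (#|row_support d| <= k)%N ->
  A *m diag_mx d *m B^T = A' *m diag_mx d *m B'^T ->
  j \in row_support d -> (row j A'^T <= rows_in A^T (row_support d))%MS.
Proof.
move=> indA indB dk AB jd; set S := row_support d; pose M := A *m diag_mx d *m B^T.
have subM (A1 : 'M[F]_(p, n)) (B1 : 'M[F]_(q, n)) :
    M = A1 *m diag_mx d *m B1^T -> (M^T <= rows_in A1^T S)%MS.
  move=> ->; rewrite (mul_diag_rows_in _ _ (subxx _)) -mulmxA trmx_mul trmxK.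
  exact: submxMl.
apply: submx_trans (row_rows_in _ jd) _; apply: submx_trans (subM A B erefl).
rewrite -(mxrank_leqif_sup (subM A' B' AB)).
rewrite eqn_leq mxrankS ?(subM A' B' AB)//= mxrank_tr /M (rank_mul_diag indA indB)//.
exact: rank_leq_row.
Qed.

(** Descending induction on [#|U|]: a smaller set containing [j] is the intersection of two sets
    with one more element, to which [rows_in_meet] applies, down to [[set j]]. *)
Lemma rows_in_line k n p (X : 'M[F]_(n, p)) j (v : 'rV_p) :
  rows_indep k X -> (1 < k <= n)%N ->
  (forall U : {set 'I_n}, j \in U -> #|U| = k.-1 -> (v <= rows_in X U)%MS) ->
  exists a, v = a *: row j X.
Proof.
move=> indX /andP[k1 kn] h.
have h' (U : {set 'I_n}) : j \in U -> (#|U| < k)%N -> (v <= rows_in X U)%MS.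
  have [m] := ubnP (k - #|U|)%N; elim: m U => // m IH U hU jU Uk.
  have [e|ne] := eqVneq #|U| k.-1; first exact: h.
  have Uk2 : (#|U|.+2 <= k)%N.
    suff : (#|U| < k.-1)%N by lia.
    by rewrite ltn_neqAle ne -ltnS prednK//; lia.
  have [a [b [ab aU bU]]] := exists_two_outside (leq_trans Uk2 kn).
  apply: (rows_in_meet indX Uk2 ab); apply: IH; rewrite ?cardsU1 ?aU ?bU ?add1n;
    by rewrite ?in_setU1 ?jU ?orbT//; lia.
have /sub_rVP[a ->] : (v <= row j X)%MS.
  apply: submx_trans (h' [set j] _ _) _; rewrite ?set11 ?cards1//.
  by apply: rows_in_sub => i; rewrite inE => /eqP->.
by exists a.
Qed.

Lemma polyadicE I J K r (A : 'M[F]_(I, r)) (B : 'M[F]_(J, r)) (C : 'M[F]_(K, r)) i j l :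
  polyadic A B C (i, j, l) = \sum_s A i s * B j s * C l s.
Proof. by rewrite /polyadic sum_ffunE; apply: eq_bigr => s _; rewrite !ffunE !mxE. Qed.

Lemma polyadic_slice I J K r (A A' : 'M[F]_(I, r)) (B B' : 'M[F]_(J, r))
    (C C' : 'M[F]_(K, r)) (x : 'cV[F]_K) :
  polyadic A B C = polyadic A' B' C' ->
  A *m diag_mx (C^T *m x)^T *m B^T = A' *m diag_mx (C'^T *m x)^T *m B'^T.
Proof.
have E (A1 : 'M[F]_(I, r)) (B1 : 'M[F]_(J, r)) (C1 : 'M[F]_(K, r)) i j :
    (A1 *m diag_mx (C1^T *m x)^T *m B1^T) i j =
    \sum_l x l 0 * polyadic A1 B1 C1 (i, j, l).
  under [RHS]eq_bigr do rewrite polyadicE mulr_sumr.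
  rewrite exchange_big mxE; apply: eq_bigr => s _.
  rewrite mul_mx_diag !mxE mulr_sumr mulr_suml; apply: eq_bigr => l _.
  by rewrite !mxE; ring.
move=> T; apply/matrixP => i j; rewrite !E.
by apply: eq_bigr => l _; rewrite T.
Qed.

(* Zero columns are allowed in A', B' and C', so that a decomposition with fewer
   than r terms, padded with zeros, is covered too. *)
Definition essentially_unique I J K r
    (A : 'M[F]_(I, r)) (B : 'M[F]_(J, r)) (C : 'M[F]_(K, r)) : Prop :=
  forall A' B' C', polyadic A B C = polyadic A' B' C' ->
  exists s : {perm 'I_r}, exists a b c : 'I_r -> F,
    forall j, a j * b j * c j = 1 /\
    [/\ col j A' = a j *: col (s j) A, col j B' = b j *: col (s j) B
      & col j C' = c j *: col (s j) C].

(** Cyclic symmetry of the three modes, which reduces the second and third conditions of the theorem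
    to the first. *)
Lemma essentially_unique_rot I J K r (A : 'M[F]_(I, r)) (B : 'M[F]_(J, r))
    (C : 'M[F]_(K, r)) : essentially_unique B C A -> essentially_unique A B C.
Proof.
move=> U A' B' C' T.
have [|s [b [c [a h]]]] := U B' C' A'.
  apply/ffunP => -[[j l] i]; have := congr1 (fun f : tensor F I J K => f (i, j, l)) T.
  rewrite !polyadicE => e; etransitivity; last first.
    by etransitivity; first exact: e; apply: eq_bigr => x _; ring.
  by apply: eq_bigr => x _; ring.
exists s, a, b, c => j; have [e [hB hC hA]] := h j; split => //.
by rewrite -e; ring.
Qed.

Lemma row_support_tr n p (X : 'M[F]_(n, p)) (x : 'cV[F]_p) :
  row_support (X *m x)^T = ~: zero_rows X x.
Proof. by apply/setP => j; rewrite !inE mxE. Qed.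

(** The annihilator construction with [Y] equal to [X], where Kruskal's condition is trivial. *)
Lemma exists_full_annihilator k n p (X : 'M[F]_(n, p)) (S : {set 'I_n}) :
  (1 < k <= n)%N -> rows_indep k X -> (\rank X <= k)%N -> #|S| = k.-1 ->
  exists x : 'cV[F]_p, zero_rows X x = S.
Proof.
move=> /andP[k1 kn] indX rX Sk.
have z x : (k.-1 <= #|zero_rows X x|)%N -> (#|zero_rows X x| <= #|zero_rows X x|)%N.
  by [].
have [|x [Sx Xx]] := @exists_annihilator F k n p X X k1 kn indX rX rX z S; first by lia.
by exists x; have [] := annihilator_zero_rows k1 kn indX rX rX z Sk Sx Xx.
Qed.

Section Factors.
Variables (I J K r : nat) (A : 'M[F]_(I, r)) (B : 'M[F]_(J, r)) (C : 'M[F]_(K, r)).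
Let k := minn K r.
Let m := (r - k + 2)%N.
Hypotheses (k1 : (1 < k)%N).
Hypothesis indC : rows_indep k C^T.

Lemma rank_min_dim (C' : 'M[F]_(K, r)) : (\rank C'^T <= k)%N.
Proof. by rewrite leq_min rank_leq_row rank_leq_col. Qed.

(** The complement of [U] has [r - m.-1 = k.-1] elements, the size that [exists_full_annihilator]
    requires. *)
Lemma slice_support (U : {set 'I_r}) : #|U| = m.-1 ->
  exists x : 'cV[F]_K, row_support (C^T *m x)^T = U.
Proof.
move=> Um; have kr : (k <= r)%N by rewrite geq_minr.
have [||x xU] := @exists_full_annihilator k _ _ C^T (~: U) _ indC (rank_min_dim C).
- by rewrite k1.
- have := cardsC U; rewrite card_ord Um /m.
  by lia.
by exists x; rewrite row_support_tr xU finset.setCK.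
Qed.

Lemma first_factors_unique (A' : 'M[F]_(I, r)) (B' : 'M[F]_(J, r)) :
  rows_indep m A^T -> rows_indep m B^T -> polyadic A B C = polyadic A' B' C ->
  exists a b : 'I_r -> F, forall j,
    [/\ a j * b j = 1, col j A' = a j *: col j A & col j B' = b j *: col j B].
Proof.
move=> indA indB T.
have kr : (k <= r)%N by rewrite geq_minr.
have mr : (1 < m <= r)%N by rewrite /m; lia.
have sl := polyadic_slice _ T.
have slT x : B *m diag_mx (C^T *m x)^T *m A^T = B' *m diag_mx (C^T *m x)^T *m A'^T.
  by apply: trmx_inj; rewrite !tr_mul_diag sl.
have exa (j : 'I_r) : exists a : F, col j A' = a *: col j A.
  have [|a aE] := rows_in_line (j := j) (v := row j A'^T) indA mr.
    move=> U jU Um; have [x xU] := slice_support Um.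
    have jx : j \in row_support (C^T *m x)^T by rewrite xU.
    have dm : (#|row_support (C^T *m x)^T| <= m)%N by rewrite xU Um leq_pred.
    by have := diag_eq_sub_rows_in indA indB dm (sl x) jx; rewrite xU.
  by exists a; apply: trmx_inj; rewrite linearZ /= !tr_col.
have exb (j : 'I_r) : exists b : F, col j B' = b *: col j B.
  have [|b bE] := rows_in_line (j := j) (v := row j B'^T) indB mr.
    move=> U jU Um; have [x xU] := slice_support Um.
    have jx : j \in row_support (C^T *m x)^T by rewrite xU.
    have dm : (#|row_support (C^T *m x)^T| <= m)%N by rewrite xU Um leq_pred.
    by have := diag_eq_sub_rows_in indB indA dm (slT x) jx; rewrite xU.
  by exists b; apply: trmx_inj; rewrite linearZ /= !tr_col.
have [a aE] := fin_all_exists exa; have [b bE] := fin_all_exists exb.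
exists a, b => j; split => //.
have [|U jU Um] := @exists_superset _ [set j] m.-1; first by rewrite cards1; lia.
have [x xU] := slice_support Um; have dE := sl x.
move: dE xU; move: (C^T *m x)^T => d dE xU.
(* Subtracting the two equal slices leaves [A *m diag_mx e *m B^T = 0]. By independence its rank
   counts the nonzero entries of [e], so [e = 0], and [d 0 j != 0] forces [a j * b j = 1]. *)
pose e := \row_s (d 0 s * (1 - a s * b s)).
have : A *m diag_mx e *m B^T = 0.
  have : A *m diag_mx d *m B^T - A' *m diag_mx d *m B'^T = 0.
    by rewrite dE subrr.
  move=> <-; apply/matrixP => i l.
  rewrite !mul_mx_diag !mxE -sumrB; apply: eq_bigr => s _; rewrite !mxE.
  have := congr1 (fun v : 'cV_I => v i 0) (aE s); rewrite !mxE => ->.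
  have := congr1 (fun v : 'cV_J => v l 0) (bE s); rewrite !mxE => ->.
  by ring.
have ed : row_support e \subset U.
  rewrite -xU; apply/fintype.subsetP => s; rewrite !inE [e _ _]mxE mulf_eq0 negb_or.
  by move=> /andP[].
move=> /(congr1 mxrank); rewrite mxrank0 (rank_mul_diag indA indB); last first.
  by apply: leq_trans (subset_leq_card ed) _; lia.
move=> /eqP; rewrite cards_eq0 => /eqP/setP/(_ j); rewrite !inE mxE mulf_eq0.
have : j \in row_support d by rewrite xU; apply: (fintype.subsetP jU); rewrite set11.
by rewrite inE => /negbTE-> /= /negbFE; rewrite subr_eq0 => /eqP.
Qed.

Lemma khatri_rao_essentially_unique :
  compound_khatri_rao_full m A B -> essentially_unique A B C.
Proof.
move=> full A' B' C' T.
have kr : (k <= r)%N by rewrite geq_minr.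
have [indA indB] := khatri_rao_indep full.
have sl x := polyadic_slice x T.
(* With [k.-1] zeros among [r] entries at most [r - k + 1 = m.-1] are nonzero, so
   [khatri_rao_weight] applies; comparing the ranks of the two slices then compares the supports. *)
have zC x : (k.-1 <= #|zero_rows C'^T x|)%N ->
    (#|zero_rows C'^T x| <= #|zero_rows C^T x|)%N.
  move=> zk; have := cardsC (zero_rows C'^T x); have := cardsC (zero_rows C^T x).
  rewrite -!row_support_tr card_ord => h h'.
  have dm := khatri_rao_weight full (sl x).
  suff : (#|row_support (C^T *m x)^T| <= #|row_support (C'^T *m x)^T|)%N by lia.
  rewrite -(rank_mul_diag indA indB); last by rewrite ltnW// dm// /m; lia.
  by rewrite sl rank_mul_diag_le.
have [s [c cE]] := permutation_lemma k1 kr indC (rank_min_dim C) (rank_min_dim C') zC.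
have cC j : col j C' = c j *: col (s j) C.
  by apply: trmx_inj; rewrite linearZ /= !tr_col (cE j).2.
have c0 j : c j != 0 := (cE j).1.
(* Undoing the permutation and moving the scaling of the third factor into the first turns the third
   factor into [C] itself. *)
pose A1 := \matrix_(i, t) (A' i (s^-1%g t) * c (s^-1%g t)).
pose B1 := \matrix_(i, t) B' i (s^-1%g t).
have [|a [b ab]] := first_factors_unique (A' := A1) (B' := B1) indA indB.
  rewrite T; apply/ffunP => -[[i j] l]; rewrite !polyadicE.
  rewrite [RHS](reindex_perm s); apply: eq_bigr => t _; rewrite !mxE permK.
  have := congr1 (fun v : 'cV_K => v l 0) (cC t); rewrite !mxE => ->.
  by ring.
exists s, (fun j => (c j)^-1 * a (s j)), (fun j => b (s j)), c => j.
have [abj aE bE] := ab (s j); split.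
  by rewrite -[RHS]abj; field; exact: c0.
split => //.
  rewrite -scalerA -aE; apply/colP => i; rewrite !mxE permK.
  by field; exact: c0.
by rewrite -bE; apply/colP => i; rewrite !mxE permK.
Qed.

End Factors.

(** A shorter decomposition, padded with zero columns, would make a zero column a nonzero multiple
    of a column of [A]; this gives the rank. For uniqueness, two decompositions are both compared
    with [A], [B], [C]. *)
Lemma essentially_unique_cpd I J K r (A : 'M[F]_(I, r)) (B : 'M[F]_(J, r))
    (C : 'M[F]_(K, r)) :
  nonzero_columns A -> nonzero_columns B -> nonzero_columns C ->
  essentially_unique A B C -> cpd_unique r (polyadic A B C).
Proof.
move=> nA nB nC U; split.
  split; first by exists A, B, C.
  move=> r' A' B' C' [_ _ _ T]; rewrite leqNgt; apply/negP => r'r.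
  pose w := widen_ord (ltnW r'r).
  pose pad p (M : 'M[F]_(p, r')) : 'M[F]_(p, r) :=
    \matrix_(i, t) \sum_(s < r') (w s == t)%:R * M i s.
  have padw p (M : 'M[F]_(p, r')) i s : pad p M i (w s) = M i s.
    rewrite mxE (bigD1 s)//= eqxx mul1r big1 ?addr0// => t ts.
    by rewrite -val_eqE /= val_eqE (negbTE ts) mul0r.
  have [|s [a [b [c h]]]] := U (pad _ A') (pad _ B') (pad _ C').
    rewrite T; apply/ffunP => -[[i j] l]; rewrite !polyadicE.
    rewrite [RHS](bigID (mem (w @: [set: 'I_r']))) /= [X in _ = _ + X]big1 ?addr0.
      rewrite big_imset; last by move=> x y _ _ /(congr1 val)/= xy; apply: val_inj.
      by rewrite /=; apply: eq_big => [x|x _]; rewrite ?inE ?padw.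
    move=> t tw; rewrite ![pad _ _ _ t]mxE.
    rewrite big1 ?mul0r// => x _; case: eqP => [xt|]; last by rewrite mul0r.
    by rewrite -xt imset_f ?inE in tw.
  pose t := Ordinal r'r; have [abc [At _ _]] := h t.
  have : col t (pad _ A') = 0.
    apply/colP => i; rewrite !mxE big1// => x _.
    case: eqP => [/(congr1 val)/= xt|]; last by rewrite mul0r.
    by have := ltn_ord x; rewrite xt ltnn.
  rewrite At => /eqP; rewrite scaler_eq0 (negbTE (nA _)) orbF => /eqP a0.
  by move: abc; rewrite a0 !mul0r => /eqP; rewrite eq_sym oner_eq0.
move=> A1 A2 B1 B2 C1 C2 [_ _ _ T1] [_ _ _ T2].
have [s1 [a1 [b1 [c1 h1]]]] := U _ _ _ T1.
have [s2 [a2 [b2 [c2 h2]]]] := U _ _ _ T2.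
have nz (x y z : F) : x * y * z = 1 -> [/\ x != 0, y != 0 & z != 0].
  move=> e; have : x * y * z != 0 by rewrite e oner_neq0.
  by rewrite !mulf_eq0 !negb_or => /andP[/andP[]].
(* Since [s1 (p j) = s2 j], column [j] of the second decomposition corresponds to column [p j] of
   the first. *)
pose p := (s2 * s1^-1)%g.
pose quot (x1 x2 : 'I_r -> F) := \row_j (x2 j / x1 (p j)).
have quotE q (M M1 M2 : 'M[F]_(q, r)) (x1 x2 : 'I_r -> F) :
    (forall j, x1 j != 0) ->
    (forall j, col j M1 = x1 j *: col (s1 j) M) ->
    (forall j, col j M2 = x2 j *: col (s2 j) M) ->
    M2 = M1 *m perm_mx p^-1 *m diag_mx (quot x1 x2).
  move=> x10 h11 h22; rewrite mul_mx_diag -col_permE; apply/matrixP => i j; rewrite !mxE.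
  have := congr1 (fun v : 'cV_q => v i 0) (h22 j); rewrite !mxE => ->.
  have := congr1 (fun v : 'cV_q => v i 0) (h11 (p j)); rewrite !mxE => ->.
  by rewrite /p permM permKV; field; exact: x10.
have qunit x1 x2 : (forall j, x1 j != 0) -> (forall j, x2 j != 0) ->
    is_diag_mx (diag_mx (quot x1 x2)) /\ diag_mx (quot x1 x2) \in unitmx.
  move=> x10 x20; split; first exact: diag_mx_is_diag.
  rewrite unitmxE det_diag unitfE; apply/prodf_neq0 => j _.
  by rewrite mxE mulf_neq0 ?invr_eq0.
have n1 j := nz _ _ _ (h1 j).1; have n2 j := nz _ _ _ (h2 j).1.
exists (perm_mx p^-1), (diag_mx (quot a1 a2)), (diag_mx (quot b1 b2)),
  (diag_mx (quot c1 c2)).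
split.
- exact: perm_mx_is_perm.
- by apply: qunit => j; [have [] := n1 j|have [] := n2 j].
- by apply: qunit => j; [have [] := n1 j|have [] := n2 j].
- by apply: qunit => j; [have [] := n1 j|have [] := n2 j].
split.
- apply: (quotE _ A) => j;
    [by have [] := n1 j|by have [_ []] := h1 j|by have [_ []] := h2 j].
- apply: (quotE _ B) => j;
    [by have [] := n1 j|by have [_ []] := h1 j|by have [_ []] := h2 j].
- apply: (quotE _ C) => j;
    [by have [] := n1 j|by have [_ []] := h1 j|by have [_ []] := h2 j].
rewrite !mulmx_diag; apply/matrixP => i j; rewrite !mxE; case: eqP => //= _.
have [a10 b10 c10] := n1 (p i); rewrite mulr1n.
transitivity ((a2 i * b2 i * c2 i) / (a1 (p i) * b1 (p i) * c1 (p i))).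
  by field; rewrite a10 b10 c10.
by rewrite (h2 i).1 (h1 (p i)).1 divr1.
Qed.

End Uniqueness.

(** * Zero sets of polynomial functions *)

Section PolynomialFunctions.
Variables (F : comNzRingType) (X : Type).
Implicit Type B : (X -> F) -> Prop.

(** The algebra of functions generated by [B]. With functions instead of formal multivariate
    polynomials, substitution and restriction to a section are plain inductions. *)
Inductive polyfun B : (X -> F) -> Prop :=
| polyfun_cst c : polyfun B (fun=> c)
| polyfun_gen f : B f -> polyfun B f
| polyfun_add f g : polyfun B f -> polyfun B g -> polyfun B (fun x => f x + g x)
| polyfun_mul f g : polyfun B f -> polyfun B g -> polyfun B (fun x => f x * g x).

Lemma polyfun_sum B (T : Type) (r : seq T) (P : pred T) (f : T -> X -> F) :
  (forall i, polyfun B (f i)) -> polyfun B (fun x => \sum_(i <- r | P i) f i x).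
Proof.
move=> h; rewrite (_ : (fun x => _) =
  fun x => foldr (fun i y => (if P i then f i x else 0) + y) 0 r).
  elim: r => [|i r IH] /=; first exact: polyfun_cst.
  by apply: polyfun_add IH; case: (P i) => //; exact: polyfun_cst.
apply/funext => x; elim: r => [|i r IH]; first by rewrite big_nil.
by rewrite big_cons /= -IH; case: (P i); rewrite ?add0r.
Qed.

Lemma polyfun_prod B (T : Type) (r : seq T) (P : pred T) (f : T -> X -> F) :
  (forall i, polyfun B (f i)) -> polyfun B (fun x => \prod_(i <- r | P i) f i x).
Proof.
move=> h; rewrite (_ : (fun x => _) =
  fun x => foldr (fun i y => (if P i then f i x else 1) * y) 1 r).
  elim: r => [|i r IH] /=; first exact: polyfun_cst.
  by apply: polyfun_mul IH; case: (P i) => //; exact: polyfun_cst.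
apply/funext => x; elim: r => [|i r IH]; first by rewrite big_nil.
by rewrite big_cons /= -IH; case: (P i); rewrite ?mul1r.
Qed.

Lemma polyfun_det B n (M : X -> 'M[F]_n) :
  (forall i j, polyfun B (fun x => M x i j)) -> polyfun B (fun x => \det (M x)).
Proof.
move=> h; apply: polyfun_sum => s; apply: polyfun_mul; first exact: polyfun_cst.
by apply: polyfun_prod => i; apply: h.
Qed.

End PolynomialFunctions.

Lemma polyfun_comp (F : comNzRingType) X Y (B : (X -> F) -> Prop)
    (B' : (Y -> F) -> Prop) (h : Y -> X) f :
  (forall b, B b -> polyfun B' (fun y => b (h y))) -> polyfun B f ->
  polyfun B' (fun y => f (h y)).
Proof.
move=> hB; elim=> [c|b /hB//|g g' _ IH _ IH'|g g' _ IH _ IH'].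
- exact: polyfun_cst.
- exact: polyfun_add.
- exact: polyfun_mul.
Qed.

Lemma polyfun_complex (R : rcfType) X (B : (X -> R[i]%C) -> Prop) (B' : (X -> R) -> Prop) f :
  (forall b, B b -> polyfun B' (fun x => complex.Re (b x)) /\
                    polyfun B' (fun x => complex.Im (b x))) ->
  polyfun B f ->
  polyfun B' (fun x => complex.Re (f x)) /\ polyfun B' (fun x => complex.Im (f x)).
Proof.
move=> hB; elim=> [c|b /hB//|g g' _ [r i] _ [r' i']|g g' _ [r i] _ [r' i']].
- by split; exact: polyfun_cst.
- split.
    rewrite (_ : (fun x => _) = fun x => complex.Re (g x) + complex.Re (g' x)).
      exact: polyfun_add.
    by apply/funext => x; case: (g x) => a b; case: (g' x).
  rewrite (_ : (fun x => _) = fun x => complex.Im (g x) + complex.Im (g' x)).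
    exact: polyfun_add.
  by apply/funext => x; case: (g x) => a b; case: (g' x).
- split.
    rewrite (_ : (fun x => _) = fun x => complex.Re (g x) * complex.Re (g' x)
        + (-1) * (complex.Im (g x) * complex.Im (g' x))).
      apply: polyfun_add; first exact: polyfun_mul.
      by apply: polyfun_mul; [exact: polyfun_cst|exact: polyfun_mul].
    by apply/funext => x; case: (g x) => a b; case: (g' x) => c d /=; rewrite mulN1r.
  rewrite (_ : (fun x => _) = fun x => complex.Re (g x) * complex.Im (g' x)
      + complex.Im (g x) * complex.Re (g' x)).
    by apply: polyfun_add; exact: polyfun_mul.
  by apply/funext => x; case: (g x) => a b; case: (g' x) => c d.
Qed.

(** * Null zero sets on the line, on products and on powers *)

Section NullZeros.
Local Open Scope classical_set_scope.
Variable R : realType.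

Definition null_zeros d (T : measurableType d) (mu : set T -> \bar R)
    (B : (T -> R) -> Prop) : Prop :=
  forall f, polyfun B f -> measurable_fun setT (f : T -> measurableTypeR R) /\
    forall x, f x != 0 -> mu [set t | f t = 0] = 0%E.

Lemma measurable_polyfun d (T : measurableType d) (B : (T -> R) -> Prop) f :
  (forall b, B b -> measurable_fun setT (b : T -> measurableTypeR R)) ->
  polyfun B f -> measurable_fun setT (f : T -> measurableTypeR R).
Proof.
move=> hB; elim=> [c|b /hB//|g g' _ IH _ IH'|g g' _ IH _ IH'].
- exact: measurable_cst.
- exact: measurable_funD.
- exact: measurable_funM.
Qed.

Lemma measurable_zeros d (T : measurableType d) (f : T -> R) :
  measurable_fun setT (f : T -> measurableTypeR R) -> measurable [set t | f t = 0].
Proof.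
move=> mf; have := mf measurableT [set (0 : measurableTypeR R)] (@measurable_set1 R 0).
by rewrite setTI.
Qed.

Lemma finite_roots (p : {poly R}) : p != 0 -> finite_set [set x | p.[x] = 0].
Proof.
move=> p0; apply: contrapT => /(infinite_set_fset (size p))[S Sp pS].
have rS : all (root p) S by apply/allP => x xS; apply/eqP; apply: Sp.
by have := max_poly_roots p0 rS (fset_uniq S); rewrite ltnNge pS.
Qed.

(** A polynomial expression in the identity is the evaluation of a univariate polynomial; a nonzero
    one has finitely many roots. *)
Lemma null_zeros_line : null_zeros (lebesgueR R) (fun f => f = id).
Proof.
move=> f pf; split; first by apply: measurable_polyfun pf => _ ->; exact: measurable_id.
have [p pE] : exists p : {poly R}, f = fun x => p.[x].
  elim: pf => [c|b ->|g g' _ [p ->] _ [p' ->]|g g' _ [p ->] _ [p' ->]].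
  - by exists c%:P; apply/funext => x; rewrite hornerC.
  - by exists 'X; apply/funext => x; rewrite hornerX.
  - by exists (p + p'); apply/funext => x; rewrite hornerD.
  - by exists (p * p'); apply/funext => x; rewrite hornerM.
move=> x; rewrite pE => px; apply: countable_lebesgue_measure0.
apply/finite_set_countable/finite_roots.
by apply: contraNneq px => ->; rewrite horner0.
Qed.

Section Product.
Context d1 d2 (T1 : measurableType d1) (T2 : measurableType d2).
Variable m1 : {sigma_finite_measure set T1 -> \bar R}.
Variable m2 : {sigma_finite_measure set T2 -> \bar R}.
Variables (B1 : (T1 -> R) -> Prop) (B2 : (T2 -> R) -> Prop).
Hypotheses (h1 : null_zeros m1 B1) (h2 : null_zeros m2 B2).

(* Fubini: if f (x0, y0) != 0 then for almost all x, f (x, y0) != 0, hence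
   the section of the zero set over x is null. *)
Lemma null_zeros_prod : null_zeros (prod_measure m1 m2)
  (fun f => (exists2 b, B1 b & f = fun t => b t.1)
         \/ (exists2 b, B2 b & f = fun t => b t.2)).
Proof.
move=> f pf.
have mf : measurable_fun setT (f : T1 * T2 -> measurableTypeR R).
  apply: measurable_polyfun pf => _ [[b Bb ->]|[b Bb ->]].
    by apply: measurableT_comp measurable_fst; have [] := h1 (polyfun_gen Bb).
  by apply: measurableT_comp measurable_snd; have [] := h2 (polyfun_gen Bb).
split=> // -[x0 y0] f0; have mZ := measurable_zeros mf.
have p1 y : polyfun B1 (fun x => f (x, y)).
  apply: (polyfun_comp _ pf) => _ [[b Bb ->]|[b Bb ->]].
    exact: polyfun_gen.
  exact: (polyfun_cst _ (b y)).
have p2 x : polyfun B2 (fun y => f (x, y)).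
  apply: (polyfun_comp _ pf) => _ [[b Bb ->]|[b Bb ->]].
    exact: (polyfun_cst _ (b x)).
  exact: polyfun_gen.
rewrite /prod_measure /product_measure1.
rewrite -(integral0 m1 setT); apply: ae_eq_integral => //.
  exact: measurable_fun_xsection.
have [mf1 n1] := h1 (p1 y0).
exists [set x | f (x, y0) = 0]; split; first exact: measurable_zeros.
  exact: n1 f0.
move=> x; apply: contra_notP => /eqP/= fx _.
rewrite -((h2 (p2 x)).2 y0 fx) /=; congr (m2 _).
by apply/seteqP; split=> y; rewrite /xsection /= ?inE//= => /set_mem.
Qed.

End Product.

Section Power.
Context d (T : measurableType d) (mu : {sigma_finite_measure set T -> \bar R}).
Variable B : (T -> R) -> Prop.
Hypothesis hB : null_zeros mu B.

(** The measure on [n.+1]-tuples is the image of a product under [tuple_cons]; pulled back,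
    coordinate zero is a generator on the first factor and the others are generators on the second.
    For [n = 0] the Dirac mass sits at the only tuple, where [f] is nonzero. *)
Lemma null_zeros_power n : null_zeros (power_measure mu n)
  (fun f => exists b i, B b /\ f = fun t : n.-tuple T => b (tnth t i)).
Proof.
elim: n => [|n IH] f pf.
all: have mf : measurable_fun setT (f : _.-tuple T -> measurableTypeR R)
  by apply: measurable_polyfun pf => _ [b [i [Bb ->]]];
    apply: measurableT_comp (measurable_tnth i); have [] := hB (polyfun_gen Bb).
- split=> // x fx; rewrite /= diracE memNset//= => fx0.
  by rewrite (tuple0 x) fx0 eqxx in fx.
- split=> // x fx; rewrite /= /cons_measure /pushforward.
  have pf' := polyfun_comp (h := @tuple_cons _ T n) _ pf.
  apply: (proj2 (null_zeros_prod hB IH (pf' _ _)) (thead x, [tuple of behead x])).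
    move=> _ [b [i [Bb ->]]]; apply: polyfun_gen.
    have [j ->|->] := unliftP ord0 i.
      right; exists (fun t => b (tnth t j)); first by exists b, j.
      by apply/funext => t; rewrite tnthS.
    by left; exists b => //; apply/funext => t; rewrite tnth0.
  by rewrite /tuple_cons /= -tuple_eta.
Qed.

End Power.

Lemma null_zeros_plane : null_zeros (lebesgueR2 R) (fun f => f = fst \/ f = snd).
Proof.
move=> f pf; apply: (null_zeros_prod null_zeros_line null_zeros_line).
apply: (polyfun_comp (h := id) _ pf) => _ [->|->]; apply: polyfun_gen.
  by left; exists id.
by right; exists id.
Qed.

Lemma lebesgue_null_zeros s n (f : 'rV[scalar_field R s]_n -> scalar_field R s)
    (v0 : 'rV[scalar_field R s]_n) :
  polyfun (fun g => exists i, g = fun v : 'rV_n => v 0 i) f -> f v0 != 0 ->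
  forall S : set 'rV_n, S `<=` [set v | f v = 0] -> lebesgue_null S.
Proof.
case: s f v0 => f v0 pf f0 S Sf.
- pose h (t : n.-tuple (measurableTypeR R)) : 'rV[R]_n := \row_i tnth t i.
  have pfh := polyfun_comp (h := h) _ pf.
  have [|mf nf] := null_zeros_power null_zeros_line (pfh _ _).
    move=> _ [i ->]; apply: polyfun_gen; exists id, i; split => //.
    by apply/funext => t; rewrite mxE.
  exists [set t | f (h t) = 0]; split; first exact: measurable_zeros.
    apply: (nf [tuple v0 0 i | i < n]); rewrite (_ : h _ = v0)//.
    by apply/rowP => i; rewrite mxE tnth_mktuple.
  by move=> t /= /Sf.
- pose h (t : n.-tuple (measurableTypeR R * measurableTypeR R)%type) : 'rV[R[i]%C]_n :=
    \row_i ((tnth t i).1 +i* (tnth t i).2)%C.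
  pose B (g : n.-tuple (measurableTypeR R * measurableTypeR R)%type -> R) :=
    exists b i, (b = fst \/ b = snd) /\ g = fun t => b (tnth t i).
  have [||pre pim] := @polyfun_complex R _
      (fun g => exists i, g = fun t => h t 0 i) B (fun t => f (h t)).
  + move=> _ [i ->]; split; apply: polyfun_gen.
      exists fst, i; split; first by left.
      by apply/funext => t; rewrite mxE.
    exists snd, i; split; first by right.
    by apply/funext => t; rewrite mxE.
  + apply: (polyfun_comp _ pf) => _ [i ->]; apply: polyfun_gen; by exists i.
  (* A complex value vanishes exactly when the sum of the squares of its parts does, so one real
     polynomial describes the zero set. *)
  have pn : polyfun B (fun t => complex.Re (f (h t)) * complex.Re (f (h t))
      + complex.Im (f (h t)) * complex.Im (f (h t))).
    by apply: polyfun_add; exact: polyfun_mul.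
  have [mf nf] := null_zeros_power null_zeros_plane pn.
  exists [set t | complex.Re (f (h t)) * complex.Re (f (h t))
      + complex.Im (f (h t)) * complex.Im (f (h t)) = 0]; split.
  + exact: measurable_zeros.
  + apply: (nf [tuple (complex.Re (v0 0 i), complex.Im (v0 0 i)) | i < n]).
    rewrite (_ : h _ = v0); last first.
      by apply/rowP => i; rewrite mxE tnth_mktuple /=; case: (v0 0 i).
    apply: contraNneq f0 => /eqP; rewrite -!expr2 paddr_eq0 ?sqr_ge0// !sqrf_eq0.
    by case: (f v0) => a b /= /andP[/eqP-> /eqP->].
  + by move=> t /= /Sf /= ->; rewrite /= mul0r addr0.
Qed.

End NullZeros.

(** * Generic uniqueness *)

Section Witness.
Variable F : fieldType.
Lemma polyfun_compound X (P : (X -> F) -> Prop) k p r (M : X -> 'M[F]_(p, r)) i j :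
  (forall a b, polyfun P (fun x => M x a b)) ->
  polyfun P (fun x => compound k (M x) i j).
Proof.
move=> pM; rewrite (_ : (fun x => _) = fun x =>
    \det (mxsub (tnth (lex_ksubset i)) (tnth (lex_ksubset j)) (M x))); last first.
  by apply/funext => x; rewrite mxE.
apply: polyfun_det => a b; rewrite (_ : (fun x => _) = fun x =>
    M x (tnth (lex_ksubset i) a) (tnth (lex_ksubset j) b))//.
by apply/funext => x; rewrite mxE.
Qed.

Hypothesis char0 : injective (fun n : nat => n%:R : F).

(** The first conclusion ranges over all parametrized factors, so that it serves for the coordinates
    of one long vector and for any cyclic order of the factors. *)
Lemma exists_uniqueness_polynomial p q n r (A0 : 'M[F]_(p, r)) (B0 : 'M[F]_(q, r)) :
  compound_khatri_rao_full (r - minn n r + 2) A0 B0 ->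
  exists f : 'M[F]_(p, r) -> 'M[F]_(q, r) -> 'M[F]_(n, r) -> F,
  [/\ forall X (P : (X -> F) -> Prop) (A : X -> 'M[F]_(p, r)) (B : X -> 'M[F]_(q, r))
        (C : X -> 'M[F]_(n, r)),
        (forall i j, polyfun P (fun x => A x i j)) ->
        (forall i j, polyfun P (fun x => B x i j)) ->
        (forall i j, polyfun P (fun x => C x i j)) ->
        polyfun P (fun x => f (A x) (B x) (C x)),
      exists C0, f A0 B0 C0 != 0
    & forall A B C, f A B C != 0 -> essentially_unique A B C].
Proof.
set k := minn n r; set m := (r - k + 2)%N => -[mp mq full].
have kn : (k <= n)%N by rewrite geq_minl.
have kr : (k <= r)%N by rewrite geq_minr.
(* Definedness of the compounds gives [m <= r], that is [r - k + 2 <= r], hence [k >= 2]. *)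
have k1 : (1 < k)%N by move: mp; rewrite leq_min /m => /andP[_]; lia.
pose KR (A : 'M[F]_(p, r)) (B : 'M[F]_(q, r)) := khatri_rao (compound m A) (compound m B).
(* [w] selects the rows of a maximal minor that is nonzero at [A0], [B0]. *)
pose w := fullrankfun full.
pose vdm (C : 'M[F]_(n, r)) := \prod_(g : {ffun 'I_k -> 'I_r} | injectiveb g)
  \det (mxsub (widen_ord kn) g C).
exists (fun A B C => \det (rowsub w (KR A B)) * vdm C); split.
- move=> X P A B C pA pB pC; apply: polyfun_mul.
    apply: polyfun_det => i j.
    rewrite (_ : (fun x => _) = fun x =>
        compound m (A x) (mxtens_unindex (w i)).1 j *
        compound m (B x) (mxtens_unindex (w i)).2 j); last first.
      by apply/funext => x; rewrite !mxE.
    by apply: polyfun_mul; apply: polyfun_compound.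
  apply: polyfun_prod => g; apply: polyfun_det => i j.
  rewrite (_ : (fun x => _) = fun x => C x (widen_ord kn i) (g j))//.
  by apply/funext => x; rewrite mxE.
(* The nodes [0, ..., r - 1] are distinct by [char0], so each injection selects a Vandermonde matrix
   with nonzero determinant. *)
- exists (\matrix_(i, j) (j : nat)%:R ^+ i); apply: mulf_neq0.
    by rewrite -unitfE -unitmxE; apply: fullrowsub_unit.
  apply/prodf_neq0 => g /injectiveP ginj.
  have -> : mxsub (widen_ord kn) g (\matrix_(i < n, j < r) (j : nat)%:R ^+ i) =
      Vandermonde k (\row_j (g j : nat)%:R) :> 'M[F]_k.
    by apply/matrixP => i j; rewrite !mxE.
  rewrite det_Vandermonde; apply/prodf_neq0 => i _; apply/prodf_neq0 => j ij.
  rewrite !mxE subr_eq0; apply: contraTneq ij => /char0/val_inj/ginj ->.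
  by rewrite ltnn.
move=> A B C; rewrite mulf_eq0 negb_or => /andP[dAB dC].
apply: khatri_rao_essentially_unique => //; last first.
  split=> //; rewrite -col_leq_rank.
  apply: leq_trans (mxrankS (rowsub_sub w (KR A B))).
  by rewrite mxrank_unit// unitmxE unitfE.
apply: minors_indep => // T /lex_ksubset_of_set[j jT].
exists (tnth (lex_ksubset j)), (widen_ord kn); split.
- exact: tnth_lex_ksubset_inj.
- by apply/fintype.subsetP => s; rewrite -jT => /tnthP[x ->]; apply: codom_f.
pose g := [ffun i => tnth (lex_ksubset j) i].
rewrite -trmx_mxsub det_tr.
have gi : injectiveb g.
  by apply/injectiveP => x y; rewrite !ffunE => /tnth_lex_ksubset_inj.
move/prodf_neq0/(_ g gi): dC; congr (\det _ != 0).
by apply/matrixP => x y; rewrite !mxE ffunE.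
Qed.

End Witness.

Lemma scalar_field_char0 (R : realType) s :
  injective (fun n : nat => n%:R : scalar_field R s).
Proof. by case: s => m n /eqP; rewrite eqr_nat => /eqP. Qed.

Lemma cpd_generically_unique_of_polynomial (R : realType) s I J K r
    (f : 'M[scalar_field R s]_(I, r) -> 'M[scalar_field R s]_(J, r) ->
         'M[scalar_field R s]_(K, r) -> scalar_field R s) A0 B0 C0 :
  (forall X (P : (X -> scalar_field R s) -> Prop)
      (A : X -> 'M[scalar_field R s]_(I, r))
      (B : X -> 'M[scalar_field R s]_(J, r))
      (C : X -> 'M[scalar_field R s]_(K, r)),
     (forall i j, polyfun P (fun x => A x i j)) ->
     (forall i j, polyfun P (fun x => B x i j)) ->
     (forall i j, polyfun P (fun x => C x i j)) ->
     polyfun P (fun x => f (A x) (B x) (C x))) ->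
  f A0 B0 C0 != 0 ->
  (forall A B C, f A B C != 0 -> essentially_unique A B C) ->
  cpd_generically_unique R s I J K r.
Proof.
move=> pf f0 fU.
pose g (v : 'rV[scalar_field R s]_((I + J + K) * r)) :=
  f (factorA v) (factorB v) (factorC v).
apply: (@lebesgue_null_zeros R s _ g (mxvec (col_mx (col_mx A0 B0) C0))).
- apply: pf => i j.
  + rewrite (_ : (fun x => _) = fun v : 'rV_((I + J + K) * r) =>
      v 0 (mxvec_index (lshift K (lshift J i)) j)); last first.
      by apply/funext => v; rewrite !mxE.
    by apply: polyfun_gen; eexists.
  + rewrite (_ : (fun x => _) = fun v : 'rV_((I + J + K) * r) =>
      v 0 (mxvec_index (lshift K (rshift I i)) j)); last first.
      by apply/funext => v; rewrite !mxE.
    by apply: polyfun_gen; eexists.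
  + rewrite (_ : (fun x => _) = fun v : 'rV_((I + J + K) * r) =>
      v 0 (mxvec_index (rshift (I + J) i) j)); last first.
      by apply/funext => v; rewrite !mxE.
    by apply: polyfun_gen; eexists.
- by rewrite /g /factorA /factorB /factorC /factor_matrix mxvecK !col_mxKu !col_mxKd.
move=> v /= [nA nB nC nU]; apply: contrapT => /eqP fv; apply: nU.
exact: essentially_unique_cpd (fU _ _ _ fv).
Qed.

Local Open Scope nat_scope.

Theorem proposition1p31 (R : realType) (s : scalars) (I J K r : nat) :
  0 < I -> 0 < J -> 0 < K -> 0 < r ->
  (exists (A0 : 'M[scalar_field R s]_(I, r)) (B0 : 'M[scalar_field R s]_(J, r))
          (C0 : 'M[scalar_field R s]_(K, r)),
     [\/ compound_khatri_rao_full (r - minn K r + 2) A0 B0,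
         compound_khatri_rao_full (r - minn I r + 2) B0 C0
       | compound_khatri_rao_full (r - minn J r + 2) C0 A0]) ->
  cpd_generically_unique R s I J K r.
Proof.
move=> _ _ _ _ [A0 [B0 [C0 []]]].
- move=> /(exists_uniqueness_polynomial (@scalar_field_char0 R s))[f [pf [Z fZ] fU]].
  exact: cpd_generically_unique_of_polynomial pf fZ fU.
- move=> /(exists_uniqueness_polynomial (@scalar_field_char0 R s))[f [pf [Z fZ] fU]].
  (* The polynomial was built for the order [B], [C], [A], so the free witness [Z] stands for [A];
     one rotation restores the order, and in the third case two do. *)
  apply: (@cpd_generically_unique_of_polynomial _ _ _ _ _ _
    (fun A B C => f B C A) Z B0 C0) => //.
    by move=> X P A B C pA pB pC; apply: pf.
  by move=> A B C /fU; apply: essentially_unique_rot.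
- move=> /(exists_uniqueness_polynomial (@scalar_field_char0 R s))[f [pf [Z fZ] fU]].
  apply: (@cpd_generically_unique_of_polynomial _ _ _ _ _ _
    (fun A B C => f C A B) A0 Z C0) => //.
    by move=> X P A B C pA pB pC; apply: pf.
  by move=> A B C /fU/essentially_unique_rot; apply: essentially_unique_rot.
Qed.
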